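(* Let $(X,d)$ be a compact metric space and let $\mathcal{H}$ be an arbitrary (complex) Hilbert space. Let $S(X)$ be the collection of all positive operator-valued measures with respect to the pair $(X,\mathcal{H})$, equipped with the generalized Kantorovich metric $\rho$. Then the metric space $(S(X),\rho)$ is complete.
   Context: $\mathscr{B}(X)$ denotes the Borel subsets of $X$ and $\mathcal{B}(\mathcal{H})$ the bounded operators on $\mathcal{H}$. An operator $L\in\mathcal{B}(\mathcal{H})$ is positive if $\langle Lh,h\rangle\ge 0$ for all $h\in\mathcal{H}$. A positive operator-valued measure (POVM) with respect to the pair $(X,\mathcal{H})$ is a map $A:\mathscr{B}(X)\to\mathcal{B}(\mathcal{H})$ such that: $A(\Delta)$ is a positive operator for all $\Delta\in\mathscr{B}(X)$; $A(\emptyset)=0$ and $A(X)=\mathrm{id}_{\mathcal{H}}$; and for every sequence $\{\Delta_n\}_{n=1}^\infty$ of pairwise disjoint sets in $\mathscr{B}(X)$ and all $g,h\in\mathcal{H}$, $\langle A(\bigcup_{n=1}^\infty\Delta_n)g,h\rangle=\sum_{n=1}^\infty\langle A(\Delta_n)g,h\rangle$. For $g,h\in\mathcal{H}$, $A_{g,h}$ denotes the complex measure $A_{g,h}(\Delta)=\langle A(\Delta)g,h\rangle$, and for a bounded Borel function $f$ on $X$, $\int f\,dA\in\mathcal{B}(\mathcal{H})$ is the unique bounded operator with $\langle(\int f\,dA)g,h\rangle=\int_X f\,dA_{g,h}$ for all $g,h\in\mathcal{H}$. Let $\mathrm{Lip}_1(X)=\{f:X\to\mathbb{R} : |f(x)-f(y)|\le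 d(x,y)\text{ for all }x,y\in X\}$. The generalized Kantorovich metric on $S(X)$ is $$\rho(A,B)=\sup_{f\in\mathrm{Lip}_1(X)}\left\|\int f\,dA-\int f\,dB\right\|,$$ where $\|\cdot\|$ is the operator norm. *)

(* Defs.v *)
From HB Require Import structures.
From mathcomp Require Import all_boot all_order all_algebra.
From mathcomp Require Import complex.
From mathcomp Require Import all_classical all_reals all_analysis.

Set Implicit Arguments.
Unset Strict Implicit.
Unset Printing Implicit Defensive.

Import Order.TTheory GRing.Theory Num.Theory.
Import numFieldNormedType.Exports.

Local Open Scope classical_set_scope.
Local Open Scope ring_scope.

Definition borel (X : topologicalType) : set (set X) := <<s @open X >>.

(* Measurable types of the library are pointed. [borel_at x0] is X with its
   Borel sigma-algebra and with distinguished point x0; the point plays no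
   other role, see [cintegral]. *)
Definition pointed_at (X : topologicalType) (x0 : X) : Type := X.

HB.instance Definition _ (X : topologicalType) (x0 : X) :=
  Choice.copy (pointed_at x0) X.
HB.instance Definition _ (X : topologicalType) (x0 : X) :=
  isPointed.Build (pointed_at x0) x0.

Notation borel_at x0 :=
  (g_sigma_algebraType (@open _ : set (set (pointed_at x0)))).

Section complex_measures.
Context (R : realType) (X : topologicalType).

(* Only the values on Borel sets are constrained. *)
Record complex_measure := ComplexMeasure {
  cmeasure :> set X -> R[i]^o ;
  cmeasure0 : cmeasure set0 = 0 ;
  cmeasure_sigma_additive : forall F : (set X)^nat,
    (forall n, borel (F n)) -> trivIset setT F ->
    (fun n => \sum_(0 <= i < n) cmeasure (F i)) @ \oo
      --> cmeasure (\bigcup_n F n) }.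

Variable nu : complex_measure.

Definition re_part (x0 : X) : set (borel_at x0) -> \bar R :=
  fun D => (complex.Re (nu D))%:E.

Definition im_part (x0 : X) : set (borel_at x0) -> \bar R :=
  fun D => (complex.Im (nu D))%:E.

End complex_measures.

Section charges.
Context (R : realType) (X : topologicalType) (nu : complex_measure R X) (x0 : X).

Lemma ltc_normRe (z : R[i]) (e : R) : `|z| < e%:C%C -> `|complex.Re z| < e.
Proof.
move=> ze; rewrite -ltcR (le_lt_trans _ ze)//.
exact: normc_ge_Re.
Qed.

Lemma ltc_normIm (z : R[i]) (e : R) : `|z| < e%:C%C -> `|complex.Im z| < e.
Proof.
move=> ze; rewrite -ltcR (le_lt_trans _ ze)//; case: z {ze} => a b.
by rewrite normc_def lecR -sqrtr_sqr ler_wsqrtr// lerDr sqr_ge0.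
Qed.

Let re_part0 : re_part nu (x0 := x0) set0 = 0%E.
Proof. by rewrite /re_part cmeasure0. Qed.

Let im_part0 : im_part nu (x0 := x0) set0 = 0%E.
Proof. by rewrite /im_part cmeasure0. Qed.

Let cvg_part (F : (set X)^nat) (p : R[i] -> R) :
  {morph p : x y / x - y} ->
  (forall z e, `|z| < e%:C%C -> `|p z| < e) ->
  (forall n, borel (F n)) -> trivIset setT F ->
  (fun n => \sum_(0 <= i < n) (p (nu (F i)))%:E)%E @ \oo
     --> (p (nu (\bigcup_n F n)))%:E.
Proof.
move=> pB pP mF tF.
have p0 : p 0 = 0 by rewrite -(subrr 0) pB subrr.
have pD : {morph p : x y / x + y}.
  by move=> x y; rewrite -{1}(opprK y) -[- y]sub0r !pB p0 sub0r opprK.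
have /cvgrPdist_lt h := @cmeasure_sigma_additive _ _ nu F mF tF.
under eq_fun do rewrite sumEFin.
apply: cvg_EFin; first by near=> n.
apply/cvgrPdist_lt => e e0.
have e0' : 0 < e%:C%C by rewrite ltcR.
apply: filterS (h _ e0') => n /pP.
by rewrite /= pB (big_morph p pD p0).
Unshelve. all: by end_near. Qed.

Let re_part_sigma : semi_sigma_additive (re_part nu (x0 := x0)).
Proof.
move=> F mF tF _.
apply: (cvg_part (p := @complex.Re R) _ ltc_normRe mF tF).
by move=> [? ?] [? ?].
Qed.

Let im_part_sigma : semi_sigma_additive (im_part nu (x0 := x0)).
Proof.
move=> F mF tF _.
apply: (cvg_part (p := @complex.Im R) _ ltc_normIm mF tF).
by move=> [? ?] [? ?].
Qed.

HB.instance Definition _ := isCharge.Build _ _ _ (re_part nu (x0 := x0))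
  re_part0 (fun _ _ => isT) re_part_sigma.

HB.instance Definition _ := isCharge.Build _ _ _ (im_part nu (x0 := x0))
  im_part0 (fun _ _ => isT) im_part_sigma.

End charges.

Definition charge_integral d (T : measurableType d) (R : realType)
    (nu : {charge set T -> \bar R}) (f : T -> R) : R :=
  let Pex := cid (Hahn_decomposition nu) in
  let Nex := cid (projT2 Pex) in
  let nuPN := projT2 Nex in
  \int[jordan_pos nuPN]_x f x - \int[jordan_neg nuPN]_x f x.

(* Integral of a real function against a complex measure, through the Jordan
   decompositions of its real and imaginary parts. The measurable space does
   not depend on the chosen point, and the integral over the empty space
   is 0. *)
Definition cintegral (R : realType) (X : topologicalType)
    (nu : complex_measure R X) (f : X -> R) : R[i] :=
  if pselect (exists x : X, True) is left Xne then
    let x0 := projT1 (cid Xne) in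
    Complex (charge_integral (re_part nu (x0 := x0)) f)
            (charge_integral (im_part nu (x0 := x0)) f)
  else 0.

(* [inner] is linear in its first argument and conjugate-linear in its
   second one. *)
HB.mixin Record isHilbert (R : realType) H & CompleteNormedModule R[i] H := {
  inner : {dot H for @conjc R} ;
  inner_norm : forall h : H, `|h| ^+ 2 = inner h h }.

#[short(type="hilbertType")]
HB.structure Definition Hilbert (R : realType) :=
  { H of isHilbert R H & CompleteNormedModule R[i] H }.

Section operators.
Context (R : realType) (H : hilbertType R).

Definition bounded_operator (T : H -> H) : Prop :=
  linear T /\ exists M : R, forall h, `|T h| <= (M%:C)%C * `|h|.

Definition positive_operator (T : H -> H) : Prop :=
  bounded_operator T /\ forall h, 0 <= inner (T h) h.

(* Norms in H take their values in R[i]; they are real. *)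
Definition operator_norm (T : H -> H) : \bar R :=
  ereal_sup [set (complex.Re `|T h|)%:E | h in [set h : H | `|h| <= 1]].

End operators.

Section povm.
Context (R : realType) (X : topologicalType) (H : hilbertType R).

(* A map from the Borel sets to the operators is extended by 0 to all sets, so
   that equality of POVMs is equality on the Borel sets. *)
Record povm := POVM {
  povm_fun :> set X -> H -> H ;
  povm_out : forall D, ~ borel D -> povm_fun D = (fun=> 0) ;
  povm_positive : forall D, borel D -> positive_operator (povm_fun D) ;
  povm0 : povm_fun set0 = (fun=> 0) ;
  povmT : povm_fun setT = id ;
  povm_sigma_additive : forall F : (set X)^nat,
    (forall n, borel (F n)) -> trivIset setT F -> forall g h : H,
    (fun n => \sum_(0 <= i < n) inner (povm_fun (F i) g) h : R[i]^o) @ \oo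
      --> (inner (povm_fun (\bigcup_n F n) g) h : R[i]^o) }.

Variable A : povm.

Lemma povm_measure0 (g h : H) : inner (A set0 g) h = 0.
Proof. by rewrite povm0 linear0l. Qed.

Definition povm_measure (g h : H) : complex_measure R X :=
  @ComplexMeasure R X (fun D => inner (A D g) h) (povm_measure0 g h)
    (fun F mF tF => @povm_sigma_additive A F mF tF g h).

Definition is_povm_integral (f : X -> R) (T : H -> H) : Prop :=
  bounded_operator T /\
  forall g h, inner (T g) h = cintegral (povm_measure g h) f.

(* The unique operator T such that [is_povm_integral f T]. *)
Definition povm_integral (f : X -> R) : H -> H :=
  xget (fun=> 0) [set T | is_povm_integral f T].

End povm.

Section kantorovich.
Context (R : realType) (X : metricType R) (H : hilbertType R).

Definition Lip1 : set (X -> R) :=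
  [set f | forall x y, `|f x - f y| <= mdist x y].

Definition kantorovich (A B : povm X H) : \bar R :=
  ereal_sup [set operator_norm (povm_integral A f \- povm_integral B f)
            | f in Lip1].

End kantorovich.

Section metric.
Context (R : realType) (S : Type) (rho : S -> S -> \bar R).
Local Open Scope ereal_scope.

Definition is_metric : Prop :=
  [/\ forall a b, 0 <= rho a b < +oo,
      forall a b, rho a b = 0 <-> a = b,
      forall a b, rho a b = rho b a &
      forall a b c, rho a c <= rho a b + rho b c].

Definition is_cauchy (u : S^nat) : Prop :=
  forall e : R, (0 < e)%R ->
    exists N, forall m n, (N <= m)%N -> (N <= n)%N -> rho (u m) (u n) < e%:E.

Definition converges_to (u : S^nat) (a : S) : Prop :=
  forall e : R, (0 < e)%R ->
    exists N, forall n, (N <= n)%N -> rho (u n) a < e%:E.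

Definition complete_metric : Prop :=
  is_metric /\ forall u, is_cauchy u -> exists a, converges_to u a.

End metric.

(* Main.v *)
Require Import Defs.
From HB Require Import structures.
From mathcomp Require Import all_boot all_order all_algebra.
From mathcomp Require Import complex.
From mathcomp Require Import ring lra.
From mathcomp Require Import all_classical all_reals all_analysis.
From mathcomp Require Import measurable_realfun.

Set Implicit Arguments.
Unset Strict Implicit.
Unset Printing Implicit Defensive.

Import Order.TTheory GRing.Theory Num.Theory.
Import numFieldNormedType.Exports.

Local Open Scope classical_set_scope.
Local Open Scope ring_scope.
Import HBNNSimple.

(** Why the Kantorovich metric on POVMs is complete.

    Everything is read off quadratic forms. The scalars are complex, so an
    operator T whose form h |-> <T h, h> is real is symmetric, is determined
    by its form, and satisfies |T h| <= c |h| for all h as soon as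
    |<T h, h>| <= c |h|^2 for all h ([represents_sym], [eq_represents],
    [sqn_represents]). For a POVM A let mu_h be the finite positive measure
    D |-> <A(D) h, h>, of mass |h|^2. The operator int f dA has the form
    h |-> int f dmu_h ([povm_integral_represents]), hence rho(A, B) is the
    least c >= 0 such that the integrals of every 1-Lipschitz f against mu^A_h
    and mu^B_h differ by at most c |h|^2 for all h ([kantorovich_leP]). This is
    a statement on scalar measures. It is finite because 1-Lipschitz functions
    on a compact space are bounded up to a constant, and mu^A_h, mu^B_h have
    the same mass; it separates POVMs because the indicator of an open set is
    an increasing limit of Lipschitz functions ([lip_approx_cvg]).

    Let now u be a Cauchy sequence. For f Lipschitz the numbers
    int f dmu^(u n)_h converge to some L_h f, at a speed that is uniform in the
    1-Lipschitz f and in the unit ball of H. The functional L_h is positive and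
    linear on Lipschitz functions, so it is the integral against a measure nu_h
    ([Rintegral_riesz_measure], the Riesz-Markov theorem on a compact metric
    space). It remains to see that, for each Borel set D, h |-> nu_h(D) is the
    form of an operator ([representable_measure]). For h |-> int f dnu_h with f
    Lipschitz this holds by uniform convergence; for D open by an increasing
    limit, because bounded increasing sequences of positive operators converge
    strongly ([representable_nondecreasing]); for D Borel by Dynkin's
    pi-lambda theorem. These operators form a POVM ([povm_of_measures]), and
    the uniform speed above is convergence to it for rho.

    The measure nu_h is the restriction of an outer measure in the manner of
    Daniell: the outer measure of E is the infimum of sup_n L F_n over the
    increasing sequences F of nonnegative Lipschitz functions that reach 1 at
    each point of E. Open sets are Caratheodory measurable since such an F can
    be cut along an open set by multiplication with Lipschitz functions
    ([caratheodory_open]), and the compactness of X, through Dini's argument,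
    makes the outer measure agree with L ([functional_le_content]). *)

(** * Operators and their quadratic forms *)

Lemma gt0_complexE (R : realType) (e : R[i]) :
  0 < e -> e = (complex.Re e)%:C%C.
Proof. by case: e => a b; rewrite ltcE /= => /andP[/eqP -> _]. Qed.

Section real_inner_product.
Context (R : realType) (H : hilbertType R).
Implicit Types (g h : H) (t : R).

(** H as a real inner product space: estimates on [rin] and [sqn] take place
    in R, while the norm of H takes its values in R[i]. *)
Definition rin g h : R := complex.Re (inner g h).
Definition sqn h : R := rin h h.

Lemma innerDl g g' h : inner (g + g') h = inner g h + inner g' h.
Proof. exact: linearDl. Qed.

Lemma innerZl (a : R[i]) g h : inner (a *: g) h = a * inner g h.
Proof. exact: linearZl_LR. Qed.

Lemma inner0l h : inner 0 h = 0.
Proof. by rewrite -(scale0r (0 : H)) innerZl mul0r. Qed.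

Lemma inner_conj g h : inner g h = (inner h g)^*%C.
Proof. by have := hermC inner g h; rewrite expr0 mul1r. Qed.

Lemma innerZr (a : R[i]) g h : inner g (a *: h) = a^*%C * inner g h.
Proof. by rewrite inner_conj innerZl rmorphM /= -inner_conj. Qed.

Lemma rinC g h : rin g h = rin h g.
Proof. by rewrite /rin inner_conj; case: (inner h g). Qed.

Lemma rinDl g g' h : rin (g + g') h = rin g h + rin g' h.
Proof. by rewrite /rin innerDl; case: (inner g h) (inner g' h) => ? ? []. Qed.

Lemma rinDr g h h' : rin g (h + h') = rin g h + rin g h'.
Proof. by rewrite rinC rinDl !(rinC g). Qed.

Lemma rinZl t g h : rin (t%:C%C *: g) h = t * rin g h.
Proof.
by rewrite /rin innerZl /=; case: (inner g h) => a b /=; rewrite mul0r subr0.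
Qed.

Lemma rinZr t g h : rin g (t%:C%C *: h) = t * rin g h.
Proof. by rewrite rinC rinZl rinC. Qed.

Lemma rinNl g h : rin (- g) h = - rin g h.
Proof.
have -> : - g = (- 1)%:C%C *: g by rewrite rmorphN1 scaleN1r.
by rewrite rinZl mulN1r.
Qed.

Lemma rinNr g h : rin g (- h) = - rin g h.
Proof. by rewrite rinC rinNl rinC. Qed.

Lemma Im_inner g h : complex.Im (inner g h) = rin g ('i%C *: h).
Proof.
rewrite /rin innerZr; case: (inner g h) => a b /=; ring.
Qed.

Lemma innerE g h : inner g h = Complex (rin g h) (rin g ('i%C *: h)).
Proof. by rewrite -Im_inner /rin; case: (inner g h). Qed.

Lemma inner_real h : inner h h = (sqn h)%:C%C.
Proof.
rewrite /sqn /rin; have := inner_conj h h; case: (inner h h) => a b [] /= bE.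
by have -> : b = 0 by lra.
Qed.

Lemma sqn_ge0 h : 0 <= sqn h.
Proof.
by rewrite -(ler0c (sqn h)) -inner_real -inner_norm exprn_ge0.
Qed.

Lemma norm_sqn h : `|h| = (Num.sqrt (sqn h))%:C%C.
Proof.
apply/eqP; rewrite -(eqrXn2 (n := 2))// ?ler0c ?sqrtr_ge0//.
by rewrite inner_norm inner_real -rmorphXn /= sqr_sqrtr ?sqn_ge0.
Qed.

Lemma sqnD g h : sqn (g + h) = sqn g + sqn h + 2 * rin g h.
Proof. by rewrite /sqn rinDl !rinDr (rinC h g); ring. Qed.

Lemma sqnB g h : sqn (g - h) = sqn g + sqn h - 2 * rin g h.
Proof. by rewrite sqnD /sqn rinNl !rinNr; ring. Qed.

Lemma sqnZ t h : sqn (t%:C%C *: h) = t ^+ 2 * sqn h.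
Proof. by rewrite /sqn rinZl rinZr; ring. Qed.

Lemma sqnN h : sqn (- h) = sqn h.
Proof. by rewrite /sqn rinNl rinNr opprK. Qed.

Lemma sqn0 : sqn 0 = 0.
Proof. by rewrite -(scale0r 0) (_ : 0 = (0 : R)%:C%C)// sqnZ expr0n mul0r. Qed.

Lemma sqn_eq0 h : sqn h = 0 -> h = 0.
Proof. by move=> h0; apply/eqP; rewrite -normr_eq0 norm_sqn h0 sqrtr0. Qed.

Lemma cauchy_schwarz g h : rin g h ^+ 2 <= sqn g * sqn h.
Proof.
have [h0|h0] := eqVneq (sqn h) 0.
  by rewrite (sqn_eq0 h0) sqn0 mulr0 rinC /rin inner0l expr0n.
have hp : 0 < sqn h by rewrite lt_neqAle eq_sym h0 sqn_ge0.
have := sqn_ge0 (g - (rin g h / sqn h)%:C%C *: h).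
rewrite sqnB sqnZ rinZr => k.
have := mulr_ge0 k (ltW hp); set x := (X in 0 <= X).
have -> : x = sqn g * sqn h - rin g h ^+ 2 by rewrite /x; field.
by rewrite subr_ge0.
Qed.

Lemma eq_inner g g' : (forall h, rin g h = rin g' h) -> g = g'.
Proof.
move=> gg'; apply/eqP; rewrite -subr_eq0; apply/eqP/sqn_eq0.
by rewrite /sqn rinDl rinNl gg' subrr.
Qed.

Definition nrm h : R := Num.sqrt (sqn h).

Lemma nrm_ge0 h : 0 <= nrm h. Proof. exact: sqrtr_ge0. Qed.

Lemma sqr_nrm h : nrm h ^+ 2 = sqn h.
Proof. by rewrite sqr_sqrtr ?sqn_ge0. Qed.

Lemma normr_rin g h : `|rin g h| <= nrm g * nrm h.
Proof.
rewrite /nrm -sqrtrM ?sqn_ge0// -sqrtr_sqr ler_sqrt ?cauchy_schwarz//.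
by rewrite mulr_ge0 ?sqn_ge0.
Qed.

Lemma cvg_rin (u : H^nat) x h :
  u @ \oo --> x -> (fun n => rin (u n) h) @ \oo --> rin x h.
Proof.
move=> /cvgrPdist_lt ux; apply/cvgrPdist_lt => e e0.
have e0' : 0 < (e / (nrm h + 1))%:C%C.
  by rewrite ltcR divr_gt0// ltr_wpDl// nrm_ge0.
apply: filterS (ux _ e0') => n /=; rewrite norm_sqn ltcR => un.
rewrite -rinNl -rinDl (le_lt_trans (normr_rin _ _))//.
rewrite (@le_lt_trans _ _ (nrm (x - u n) * (nrm h + 1)))//.
  by rewrite ler_wpM2l ?nrm_ge0// lerDl.
by rewrite -ltr_pdivlMr// ltr_wpDl// nrm_ge0.
Qed.

End real_inner_product.

Section quadratic_forms.
Context (R : realType) (H : hilbertType R).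
Implicit Types (g h : H) (T : H -> H) (Q : H -> R).

(** Over the complex scalars a real quadratic form determines the operator, its
    symmetry and its norm; operators are therefore built and compared through
    their forms. *)
Definition represents T Q :=
  linear T /\ forall h, inner (T h) h = (Q h)%:C%C.

Definition representable Q := exists T, represents T Q.

Section represented_form.
Context (T : H -> H) (Q : H -> R).
Hypothesis TQ : represents T Q.

Lemma represents0 : T 0 = 0.
Proof.
by have [l _] := TQ; have := l (- 1) 0 0; rewrite scaler0 addr0 scaleN1r addNr.
Qed.

Lemma representsD g h : T (g + h) = T g + T h.
Proof. by have [l _] := TQ; have := l 1 g h; rewrite !scale1r. Qed.

Lemma representsZ (a : R[i]) h : T (a *: h) = a *: T h.
Proof. by have [l _] := TQ; have := l a h 0; rewrite represents0 !addr0. Qed.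

Lemma representsN h : T (- h) = - T h.
Proof. by rewrite -scaleN1r representsZ scaleN1r. Qed.

Lemma form_rin h : Q h = rin (T h) h.
Proof. by have [_ q] := TQ; rewrite /rin q. Qed.

(** The form is real at u and at u + v, so the imaginary part of
    <T u, v> + <T v, u> vanishes; at v = i h this is the symmetry of T. *)
Lemma represents_sym g h : rin (T g) h = rin g (T h).
Proof.
have im k : rin (T k) ('i%C *: k) = 0.
  by have [_ q] := TQ; rewrite -Im_inner q.
have cross u v : rin (T u) ('i%C *: v) + rin (T v) ('i%C *: u) = 0.
  have := im (u + v); rewrite representsD scalerDr rinDl !rinDr !im.
  by rewrite add0r addr0.
have ii k : 'i%C *: ('i%C *: k) = - k :> H.
  by rewrite scalerA -expr2 sqr_i scaleN1r.
have iN x y : rin ('i%C *: x) y = - rin x ('i%C *: y).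
  rewrite rinC /rin !innerZr (inner_conj x y).
  by case: (inner y x) => a b /=; ring.
have := cross g ('i%C *: h).
by rewrite ii rinNr representsZ iN ii rinNr opprK (rinC (T h)); lra.
Qed.

Lemma polarization g h : 4 * rin (T g) h = Q (g + h) - Q (g - h).
Proof.
rewrite !form_rin !representsD representsN !rinDl !rinDr !rinNl !rinNr.
by rewrite (represents_sym h g) (rinC h); ring.
Qed.

(** With the factor inside the vectors, <T g, h> is a difference of two values
    of Q; for the forms h |-> mu_h(D) this gives a difference of two of the
    measures themselves, without rescaling them. *)
Lemma polarization_half g h : rin (T g) h =
  Q (2^-1%:C%C *: (g + h)) - Q (2^-1%:C%C *: (g - h)).
Proof.
have := polarization g h; rewrite !form_rin !representsZ !rinZl !rinZr; lra.
Qed.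

Lemma formBZ g h (t : R) :
  Q (g - t%:C%C *: h) = Q g - 2 * t * rin (T g) h + t ^+ 2 * Q h.
Proof.
rewrite !form_rin !representsD representsN representsZ !rinDl !rinDr !rinNl.
rewrite !rinNr !rinZl !rinZr (represents_sym h g) (rinC h); ring.
Qed.

(** Polarize 4 <T g, t T g>, bound the two values of Q and use the
    parallelogram law; t = 1/c is the optimal choice. *)
Lemma sqn_represents (c : R) : 0 <= c -> (forall h, `|Q h| <= c * sqn h) ->
  forall g, sqn (T g) <= c ^+ 2 * sqn g.
Proof.
move=> c0 Qc g.
have k (t : R) : 4 * t * sqn (T g) <= 2 * c * (sqn g + t ^+ 2 * sqn (T g)).
  have := polarization g (t%:C%C *: T g); rewrite rinZr -/(sqn _) => E.
  rewrite -mulrA E (@le_trans _ _ (`|Q (g + t%:C%C *: T g)| +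
     `|Q (g - t%:C%C *: T g)|))//.
    by rewrite (le_trans (ler_norm _))// (le_trans (ler_normB _ _)).
  rewrite (le_trans (lerD (Qc _) (Qc _)))// sqnD sqnB !sqnZ.
  lra.
have [c00|cn0] := eqVneq c 0.
  by have := k 1; rewrite c00 expr0n /=; lra.
have cp : 0 < c by rewrite lt_neqAle eq_sym cn0.
have := k c^-1; set S := sqn (T g); set G := sqn g => kc.
have E1 : c * (c^-1 ^+ 2 * S) = c^-1 * S by field.
have E2 : c * (c^-1 * S) = S by field.
have kc' : c^-1 * S <= c * G by lra.
by rewrite -E2 expr2 -mulrA ler_wpM2l.
Qed.

(** The Cauchy-Schwarz inequality for the semi-inner product <T ., .>, applied
    to g and T g; it comes from 0 <= Q (g - T g / c). *)
Lemma sqn_represents_ge0 (c : R) : 0 <= c ->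
  (forall h, 0 <= Q h <= c * sqn h) -> forall g, sqn (T g) <= c * Q g.
Proof.
move=> c0 Qc g.
have [c00|cn0] := eqVneq c 0.
  have Q0 h : `|Q h| <= c * sqn h.
    by have /andP[h0 hc] := Qc h; rewrite ger0_norm.
  by have := sqn_represents c0 Q0 g; rewrite c00 expr0n !mul0r.
have cp : 0 < c by rewrite lt_neqAle eq_sym cn0.
have := formBZ g (T g) c^-1; rewrite -/(sqn _).
have /andP[+ _] := Qc (g - c^-1%:C%C *: T g).
have /andP[_] := Qc (T g).
set S := sqn (T g); set q := Q _; set r := Q _ => qS r0 rE.
have E1 : c * (c^-1 ^+ 2 * S) = c^-1 * S by field.
have E2 : c * (c^-1 * S) = S by field.
have := ler_wpM2l (sqr_ge0 c^-1) qS => qS'.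
have : c^-1 * S <= Q g by lra.
by move=> /(ler_wpM2l c0); rewrite E2.
Qed.

End represented_form.

Lemma eq_represents T T' Q : represents T Q -> represents T' Q -> T = T'.
Proof.
move=> TQ T'Q; apply/funext => g; apply: eq_inner => h.
by have := polarization TQ g h; rewrite -(polarization T'Q g h); lra.
Qed.

Lemma represents_id : represents id (@sqn R H).
Proof. by split=> // h; rewrite inner_real. Qed.

Lemma represents_zero : represents (fun=> 0) (fun=> 0).
Proof.
split=> [a u v|h]; first by rewrite scaler0 addr0.
exact: inner0l.
Qed.

Lemma represents_add T Q T' Q' : represents T Q -> represents T' Q' ->
  represents (fun h => T h + T' h) (fun h => Q h + Q' h).
Proof.
move=> [l q] [l' q']; split=> [a u v|h].
  by rewrite l l' scalerDr addrACA.
by rewrite innerDl q q' rmorphD.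
Qed.

Lemma represents_scale (t : R) T Q : represents T Q ->
  represents (fun h => t%:C%C *: T h) (fun h => t * Q h).
Proof.
move=> [l q]; split=> [a u v|h].
  by rewrite l scalerDr !scalerA mulrC.
by rewrite innerZl q rmorphM.
Qed.

Lemma represents_sub T Q T' Q' : represents T Q -> represents T' Q' ->
  represents (T \- T') (fun h => Q h - Q' h).
Proof.
move=> TQ /(represents_scale (-1)) /(represents_add TQ).
congr represents; apply/funext => h /=.
  by rewrite rmorphN1 scaleN1r.
by rewrite mulN1r.
Qed.

(** Completeness of H turns sequences [T_^~ h] that are Cauchy into a strong
    limit, whose form is the limit of the forms. *)
Lemma representable_lim (T_ : nat -> H -> H) (Q_ : nat -> H -> R) (Q : H -> R) :
  (forall n, represents (T_ n) (Q_ n)) ->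
  (forall h (e : R), 0 < e ->
     exists N, forall n, (N <= n)%N -> sqn (T_ N h - T_ n h) < e) ->
  (forall h, Q_^~ h @ \oo --> Q h) ->
  representable Q.
Proof.
move=> TQ Tcau QQ.
have Tcvg h : cvgn (T_^~ h).
  apply/cauchy_cvgP/cauchy_exP => e e0.
  have eE := gt0_complexE e0.
  have e0' : 0 < complex.Re e by rewrite -ltcR -eE.
  have [N NT] := Tcau h (complex.Re e ^+ 2) (exprn_gt0 2 e0').
  exists (T_ N h); exists N => // n /NT TN.
  rewrite -ball_normE /= norm_sqn eE ltcR.
  rewrite -(gtr0_norm e0') -sqrtr_sqr ltr_sqrt//.
  by rewrite exprn_gt0.
pose T h := limn (T_^~ h).
have TT h : T_^~ h @ \oo --> T h by exact: Tcvg.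
exists T; split=> [a u v|h].
  apply: cvg_lim; first exact: norm_hausdorff.
  have -> : T_ ^~ (a *: u + v) = fun n => a *: T_ n u + T_ n v.
    by apply/funext => n; case: (TQ n) => l _; rewrite l.
  exact: (cvgD (cvgZl_tmp (TT u)) (TT v)).
rewrite innerE.
have -> : rin (T h) h = Q h.
  rewrite -(cvg_lim (@norm_hausdorff _ _) (cvg_rin (TT h))).
  apply: cvg_lim; first exact: norm_hausdorff.
  rewrite (_ : (fun n => _) = Q_^~ h)//.
  by apply/funext => n; rewrite -(form_rin (TQ n)).
have -> // : rin (T h) ('i%C *: h) = 0.
rewrite -(cvg_lim (@norm_hausdorff _ _) (cvg_rin (TT h))).
apply: cvg_lim; first exact: norm_hausdorff.
have -> : (fun n => rin (T_ n h) ('i%C *: h)) = fun=> 0.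
  by apply/funext => n; case: (TQ n) => _ q; rewrite -Im_inner q.
exact: cvg_cst.
Qed.

(** Bounded increasing sequences of positive operators converge strongly: by
    [sqn_represents_ge0], |(T_n - T_N) h|^2 <= c (Q_n h - Q_N h), and the right
    hand side is small because the real sequence Q_n h converges. *)
Lemma representable_nondecreasing (Q_ : nat -> H -> R) (Q : H -> R) (c : R) :
  0 <= c -> (forall n, representable (Q_ n)) ->
  (forall n h, 0 <= Q_ n h <= c * sqn h) ->
  (forall h, nondecreasing_seq (Q_^~ h)) ->
  (forall h, Q_^~ h @ \oo --> Q h) ->
  representable Q.
Proof.
move=> c0 /choice[T_ TQ] Qc Qnd QQ; apply: (representable_lim TQ) => // h e e0.
have e0' : 0 < e / (c + 1) by rewrite divr_gt0// ltr_wpDl.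
have /cvgrPdist_lt/(_ _ e0')[N _ NQ] := QQ h.
exists N => n Nn; rewrite -sqnN opprB.
have TnN := represents_sub (TQ n) (TQ N).
have QnN k : 0 <= Q_ n k - Q_ N k <= c * sqn k.
  rewrite subr_ge0 Qnd//= lerBlDr.
  by have /andP[_] := Qc n k; have /andP[] := Qc N k; lra.
rewrite (le_lt_trans (sqn_represents_ge0 TnN c0 QnN h))//.
have QnQ : Q_ n h <= Q h.
  rewrite -(cvg_lim (@norm_hausdorff _ _) (QQ h)).
  by apply: nondecreasing_cvgn_le => //; apply/cvg_ex; exists (Q h); exact: QQ.
have := NQ N (leqnn N); rewrite /= ltr_norml => /andP[_ QN].
have : Q_ n h - Q_ N h < e / (c + 1) by lra.
rewrite ltr_pdivlMr ?ltr_wpDl// => /le_lt_trans; apply.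
by rewrite mulrC ler_wpM2l ?lerDl//; have /andP[] := QnN h.
Qed.

(** On symmetric operators a uniform bound of the form is a bound of the norm,
    so the operators are Cauchy. *)
Lemma representable_uniform (Q_ : nat -> H -> R) (Q : H -> R) :
  (forall n, representable (Q_ n)) ->
  (forall e : R, 0 < e -> exists N, forall n, (N <= n)%N ->
     forall h, `|Q_ n h - Q h| <= e * sqn h) ->
  representable Q.
Proof.
move=> /choice[T_ TQ] QQ; apply: (representable_lim TQ) => [h e e0|h].
  pose d := Num.min 1 (e / (4 * (sqn h + 1))).
  have h1 : 0 < 4 * (sqn h + 1) by rewrite mulr_gt0// ltr_wpDl// sqn_ge0.
  have d0 : 0 < d by rewrite lt_min ltr01 divr_gt0.
  have [N NQ] := QQ d d0; exists N => n Nn.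
  have dQ k : `|Q_ N k - Q_ n k| <= (2 * d) * sqn k.
    rewrite -(subrKA (Q k)) (le_trans (ler_normD _ _))//.
    rewrite -mulrA mulr_natl mulr2n lerD ?NQ//.
    by rewrite distrC NQ.
  have d20 : 0 <= 2 * d by rewrite mulr_ge0// ltW.
  have := sqn_represents (represents_sub (TQ N) (TQ n)) d20 dQ h.
  move=> /le_lt_trans; apply.
  have d1 : d <= 1 by rewrite ge_min lexx.
  have : d <= e / (4 * (sqn h + 1)) by rewrite ge_min lexx orbT.
  rewrite ler_pdivlMr// => de.
  have := sqn_ge0 h; nra.
apply/cvgrPdist_le => e e0.
have e0' : 0 < e / (sqn h + 1) by rewrite divr_gt0// ltr_wpDl// sqn_ge0.
have [N NQ] := QQ _ e0'; exists N => // n /NQ/(_ h); rewrite distrC.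
move=> /le_trans; apply; rewrite mulrAC ler_pdivrMr ?ltr_wpDl// ?sqn_ge0//.
by rewrite ler_wpM2l ?lerDl// ltW.
Qed.

(** Norm and numerical radius agree on symmetric operators. *)
Lemma operator_norm_leP T Q (c : R) : represents T Q -> 0 <= c ->
  (operator_norm T <= c%:E)%E <-> forall h, `|Q h| <= c * sqn h.
Proof.
move=> TQ c0; split=> [Tc h|Qc].
  have [h0|h0] := eqVneq (sqn h) 0.
    rewrite (sqn_eq0 h0) (form_rin TQ) (represents0 TQ) -/(sqn _) sqn0.
    by rewrite mulr0 normr0.
  have hp : 0 < sqn h by rewrite lt_neqAle eq_sym h0 sqn_ge0.
  have np : 0 < nrm h by rewrite sqrtr_gt0.
  pose u := (nrm h)^-1%:C%C *: h.
  have u1 : sqn u = 1.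
    by rewrite sqnZ exprVn sqr_nrm mulVf.
  have Tu : nrm (T u) <= c.
    rewrite -lee_fin (le_trans _ Tc)//; apply: ereal_sup_ubound.
    by exists u => /=; rewrite norm_sqn// u1 sqrtr1.
  have -> : Q h = sqn h * Q u.
    rewrite !(form_rin TQ) /u (representsZ TQ) rinZl rinZr -(sqr_nrm h).
    by field; rewrite gt_eqF.
  rewrite normrM ger0_norm ?sqn_ge0// mulrC ler_wpM2r ?sqn_ge0//.
  rewrite (form_rin TQ) (le_trans (normr_rin _ _))//.
  by rewrite {2}/nrm u1 sqrtr1 mulr1.
apply: ub_ereal_sup => _ [h /= h1 <-]; rewrite lee_fin norm_sqn /=.
move: h1; rewrite norm_sqn lecR => h1.
have h1' : sqn h <= 1 by rewrite -sqr_nrm expr_le1// nrm_ge0.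
rewrite -(ger0_norm c0) -sqrtr_sqr ler_sqrt ?sqr_ge0//.
by rewrite (le_trans (sqn_represents TQ c0 Qc h))// ler_piMr// sqr_ge0.
Qed.

Lemma represents_bounded T Q (c : R) : represents T Q -> 0 <= c ->
  (forall h, `|Q h| <= c * sqn h) -> bounded_operator T.
Proof.
move=> TQ c0 Qc; split; first by case: TQ.
exists c => h; rewrite !norm_sqn -rmorphM lecR.
rewrite -(ger0_norm c0) -sqrtr_sqr -sqrtrM ?sqr_ge0//.
rewrite ler_sqrt ?mulr_ge0 ?sqr_ge0 ?sqn_ge0//.
exact: (sqn_represents TQ).
Qed.

End quadratic_forms.

(** * Integrals of bounded functions, and the measures of a POVM *)

Section bounded_measurable.
Context d (T : measurableType d) (R : realType).
Implicit Types (mu : {finite_measure set T -> \bar R}) (f g : T -> R).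

Definition bounded_measurable f : Prop :=
  measurable_fun setT f /\ exists M : R, forall x, `|f x| <= M.

Lemma bounded_measurable_cst (c : R) : bounded_measurable (cst c).
Proof. by split; [exact: measurable_cst|exists `|c|]. Qed.

Lemma bounded_measurableD f g : bounded_measurable f -> bounded_measurable g ->
  bounded_measurable (fun x => f x + g x).
Proof.
move=> [mf [M fM]] [mg [N gN]]; split; first exact: measurable_funD.
by exists (M + N) => x; rewrite (le_trans (ler_normD _ _))// lerD.
Qed.

Lemma bounded_measurableZ (c : R) f : bounded_measurable f ->
  bounded_measurable (fun x => c * f x).
Proof.
move=> [mf [M fM]]; split; first exact: measurable_funM.
by exists (`|c| * M) => x; rewrite normrM ler_wpM2l.
Qed.

Lemma bounded_measurable_indic (A : set T) : measurable A ->
  bounded_measurable \1_A.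
Proof.
move=> mA; split; first exact: measurable_indic.
by exists 1 => x; rewrite indicE; case: (x \in A); rewrite ?normr1 ?normr0.
Qed.

Lemma bounded_integrable mu f : bounded_measurable f ->
  mu.-integrable setT (EFin \o f).
Proof.
move=> [mf [M fM]]; apply: measurable_bounded_integrable => //.
  by rewrite -ge0_fin_numE ?fin_num_measure.
exists M; split; first exact: num_real.
by move=> N MN x _ /=; rewrite (le_trans (fM x))// ltW.
Qed.

Lemma RintegralD_bounded mu f g : bounded_measurable f -> bounded_measurable g ->
  \int[mu]_x (f x + g x) = \int[mu]_x f x + \int[mu]_x g x.
Proof. by move=> bf bg; rewrite RintegralD//; exact: bounded_integrable. Qed.

Lemma RintegralZ_bounded mu (c : R) f : bounded_measurable f ->
  \int[mu]_x (c * f x) = c * \int[mu]_x f x.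
Proof. by move=> bf; rewrite RintegralZl//; exact: bounded_integrable. Qed.

Lemma le_Rintegral_bounded mu f g : bounded_measurable f ->
  bounded_measurable g -> (forall x, f x <= g x) ->
  \int[mu]_x f x <= \int[mu]_x g x.
Proof.
by move=> bf bg fg; rewrite le_Rintegral//; exact: bounded_integrable.
Qed.

Lemma Rintegral_indicT mu (A : set T) : measurable A ->
  \int[mu]_x \1_A x = fine (mu A).
Proof. by move=> mA; rewrite /Rintegral integral_indic// setIT. Qed.

Lemma Rintegral_cvg_bounded mu (f_ : (T -> R)^nat) f (M : R) :
  (forall n, measurable_fun setT (f_ n)) -> (forall n x, `|f_ n x| <= M) ->
  (forall x, f_^~ x @ \oo --> f x) ->
  (fun n => \int[mu]_x f_ n x) @ \oo --> \int[mu]_x f x.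
Proof.
move=> mf_ fM ff.
have mf : measurable_fun setT f by exact: (measurable_fun_cvg mf_).
have bM : mu.-integrable setT (EFin \o cst M).
  exact: bounded_integrable (bounded_measurable_cst M).
have [||||fi _ fc] := @dominated_convergence _ _ _ mu setT measurableT
    (fun n => EFin \o f_ n) (EFin \o f) (EFin \o cst M) _ _ _ bM.
- by move=> n; exact/measurable_EFinP.
- exact/measurable_EFinP.
- by apply: aeW => x _ /=; apply: cvg_EFin; [exact: nearW|exact: ff].
- by apply: aeW => x n _ /=; rewrite lee_fin.
apply: fine_cvg; rewrite fineK//; exact: integrable_fin_num.
Qed.

Lemma Rintegral_le_mass mu f (M : R) : bounded_measurable f ->
  (forall x, `|f x| <= M) -> `|\int[mu]_x f x| <= M * fine (mu setT).
Proof.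
move=> bf fM; rewrite -Rintegral_cst//.
rewrite (le_trans (le_normr_Rintegral _ (bounded_integrable mu bf)))//.
apply: le_Rintegral_bounded => //; last exact: bounded_measurable_cst.
case: bf => mf _; split; first exact: measurableT_comp.
by exists M => x; rewrite normr_id.
Qed.

(** Any decomposition of a charge as a difference of finite measures computes
    its integrals: nu = mu1 - mu2 means nu^+ + mu2 = mu1 + nu^-, and integrals
    are additive in the measure. *)
Lemma jordan_integralB (nu : {charge set T -> \bar R}) (P N : set T)
    (pn : hahn_decomposition nu P N) mu1 mu2 f :
  (forall A, measurable A -> nu A = mu1 A - mu2 A)%E -> bounded_measurable f ->
  \int[jordan_pos pn]_x f x - \int[jordan_neg pn]_x f x =
  \int[mu1]_x f x - \int[mu2]_x f x.
Proof.
move=> nuE bf; set p := jordan_pos pn; set n := jordan_neg pn.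
have bi (m : {finite_measure set T -> \bar R}) := bounded_integrable m bf.
suff E : (\int[p]_x (f x)%:E + \int[mu2]_x (f x)%:E =
          \int[mu1]_x (f x)%:E + \int[n]_x (f x)%:E)%E.
  have IE (m : {finite_measure set T -> \bar R}) :
      (\int[m]_x (f x)%:E = (\int[m]_x f x)%:E)%E.
    by rewrite /Rintegral fineK//; exact: integrable_fin_num (bi m).
  by move: E; rewrite !IE -!EFinD => -[E]; lra.
have := @integral_measure_add _ _ _ p mu2 setT measurableT _ (bi _) (bi _).
rewrite /= => <-.
have := @integral_measure_add _ _ _ mu1 n setT measurableT _ (bi _) (bi _).
rewrite /= => <-.
apply: eq_measure_integral => A mA _.
transitivity (p A + mu2 A)%E; first exact: measure_addE.
transitivity (mu1 A + n A)%E; last by rewrite -measure_addE.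
have : nu A = (p A - n A)%E.
  by rewrite (jordan_decomp pn mA) /cadd; congr adde; exact: mulN1e.
rewrite nuE//.
have pf : p A \is a fin_num by exact: fin_num_measure.
have nf : n A \is a fin_num by exact: fin_num_measure.
have f1 : mu1 A \is a fin_num by exact: fin_num_measure.
have f2 : mu2 A \is a fin_num by exact: fin_num_measure.
rewrite -(fineK pf) -(fineK nf) -(fineK f1) -(fineK f2).
by move=> [E]; rewrite -!EFinD; congr EFin; lra.
Qed.

Lemma charge_integralB (nu : {charge set T -> \bar R}) mu1 mu2 f :
  (forall A, measurable A -> nu A = mu1 A - mu2 A)%E -> bounded_measurable f ->
  charge_integral nu f = \int[mu1]_x f x - \int[mu2]_x f x.
Proof. by move=> nuE bf; exact: jordan_integralB. Qed.

End bounded_measurable.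
Section measure_family.
Context d (T : measurableType d) (R : realType) (H : hilbertType R).
Variable mu : H -> {finite_measure set T -> \bar R}.
Hypothesis mu_mass : forall h, fine (mu h setT) = sqn h.
Hypothesis mu_rep :
  forall A, measurable A -> representable (fun h => fine (mu h A)).

Lemma representable_simple (s : seq R) (E : R -> set T) :
  (forall y, measurable (E y)) ->
  representable (fun h => \int[mu h]_x (\sum_(y <- s) y * \1_(E y) x)).
Proof.
move=> mE; have bE y := bounded_measurable_indic R (mE y).
suff : bounded_measurable (fun x => \sum_(y <- s) y * \1_(E y) x) /\
  representable (fun h => \int[mu h]_x (\sum_(y <- s) y * \1_(E y) x)) by case.
elim: s => [|y s [bs [S Ss]]].
  under [X in bounded_measurable X]eq_fun do rewrite big_nil.
  split; first exact: bounded_measurable_cst.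
  exists (fun=> 0); rewrite (_ : (fun h => _) = fun=> 0).
    exact: represents_zero.
  apply/funext => h; under eq_Rintegral do rewrite big_nil.
  by rewrite Rintegral_cst// mul0r.
under [X in bounded_measurable X]eq_fun do rewrite big_cons.
have bys := bounded_measurableZ y (bE y).
split; first exact: (bounded_measurableD bys bs).
have [U US] := mu_rep (mE y).
exists (fun h => y%:C%C *: U h + S h).
rewrite (_ : (fun h => _) = fun h => y * fine (mu h (E y)) +
    \int[mu h]_x (\sum_(y <- s) y * \1_(E y) x)).
  exact: represents_add (represents_scale y US) Ss.
apply/funext => h; under eq_Rintegral do rewrite big_cons.
by rewrite (RintegralD_bounded _ bys bs) RintegralZ_bounded// Rintegral_indicT.
Qed.

(** A nonnegative f is an increasing limit of simple functions, whose integrals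
    are combinations of the forms h |-> mu_h(A). *)
Lemma representable_Rintegral_ge0 (f : T -> R) :
  bounded_measurable f -> (forall x, 0 <= f x) ->
  representable (fun h => \int[mu h]_x f x).
Proof.
move=> [mf [M fM]] f0.
have M0 : 0 <= `|M| by [].
have mEf : measurable_fun setT (EFin \o f) by exact/measurable_EFinP.
have [|g [gnd gf]] := @approximation _ _ _ setT measurableT (EFin \o f) mEf.
  by move=> x _; rewrite /= lee_fin.
have gcvg x : g^~ x @ \oo --> f x.
  have /fine_cvg := gf x I; exact.
have gle n x : g n x <= f x.
  rewrite -(cvg_lim (@norm_hausdorff _ _) (gcvg x)).
  apply: (@nondecreasing_cvgn_le _ (g^~ x)).
    by move=> i j ij; have /lefP/(_ x) := gnd i j ij.
  by apply/cvg_ex; exists (f x); exact: gcvg.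
have gM n x : `|g n x| <= `|M|.
  rewrite ger0_norm ?(fun_ge0 (g n))// (le_trans (gle n x))//.
  by rewrite (le_trans (ler_norm _))// (le_trans (fM x))// ler_norm.
have bg n : bounded_measurable (g n) by split=> //; exists `|M|.
apply: (@representable_nondecreasing _ _
  (fun n h => \int[mu h]_x g n x) _ `|M|).
- by [].
- move=> n.
  have [s sE] : exists s : seq R, forall x,
      g n x = \sum_(y <- s) y * \1_(g n @^-1` [set y]) x.
    exists (finmap.enum_fset (fset_set (range (g n)))) => x.
    by rewrite (fimfunE (g n)) fsbig_finite.
  rewrite (_ : (fun h => _) =
      fun h => \int[mu h]_x (\sum_(y <- s) y * \1_(g n @^-1` [set y]) x)).
    by apply: representable_simple => y; rewrite -[X in measurable X]setTI;
      exact: measurable_funP.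
  by apply/funext => h; apply: eq_Rintegral => x _; exact: sE.
- move=> n h; rewrite Rintegral_ge0//= -?mu_mass.
  by rewrite (le_trans (ler_norm _))// Rintegral_le_mass.
- move=> h i j ij; apply: le_Rintegral_bounded => // x.
  by have /lefP/(_ x) := gnd i j ij.
- move=> h; apply: Rintegral_cvg_bounded => // n; exact: (bg n).1.
Qed.

Lemma representable_Rintegral (f : T -> R) :
  bounded_measurable f -> representable (fun h => \int[mu h]_x f x).
Proof.
move=> bf; have [mf [M fM]] := bf.
have bM := bounded_measurable_cst T M.
have [|x|S SE] := @representable_Rintegral_ge0 (fun x => f x + M).
- exact: bounded_measurableD bf bM.
- by have := fM x; rewrite ler_norml => /andP[]; lra.
exists (S \- (fun h => M%:C%C *: h)).
rewrite (_ : (fun h => _) = fun h => \int[mu h]_x (f x + M) - M * sqn h).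
  exact: represents_sub SE (represents_scale M (represents_id H)).
apply/funext => h; rewrite (RintegralD_bounded _ bf bM) Rintegral_cst//.
by rewrite mu_mass addrK.
Qed.

End measure_family.
Section povm_measures.
Context (R : realType) (X : topologicalType) (x0 : X) (H : hilbertType R).
Variable A : povm X H.

Lemma povm_linear (D : set X) : linear (A D).
Proof.
have [bD|nD] := pselect (borel D); first by have [[]] := povm_positive A bD.
by rewrite (povm_out A nD) => a u v; rewrite scaler0 addr0.
Qed.

Lemma povm_represents (D : set X) :
  represents (A D) (fun h => rin (A D h) h).
Proof.
split=> [|h]; first exact: povm_linear.
have [bD|nD] := pselect (borel D).
  have [_ /(_ h)] := povm_positive A bD.
  by rewrite lecE /= /rin; case: (inner _ _) => a b /= /andP[/eqP -> _].
by rewrite (povm_out A nD) /rin inner0l.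
Qed.

Lemma povm_form_ge0 (D : set X) h : 0 <= rin (A D h) h.
Proof.
have [bD|nD] := pselect (borel D).
  by have [_ /(_ h)] := povm_positive A bD; rewrite lecE => /andP[].
by rewrite (povm_out A nD) /rin inner0l.
Qed.

Let re_part_ge0 (h : H) (D : set (borel_at x0)) :
  (0 <= re_part (povm_measure A h h) (x0 := x0) D)%E.
Proof. by rewrite lee_fin; exact: povm_form_ge0. Qed.

Definition povm_diag (h : H) : set (borel_at x0) -> \bar R :=
  measure_of_charge (re_part (povm_measure A h h) (x0 := x0)) (re_part_ge0 h).

HB.instance Definition _ h := Measure.on (povm_diag h).

Lemma povm_diagE h (D : set X) : povm_diag h D = (rin (A D h) h)%:E.
Proof. by []. Qed.

Let povm_diag_fin h : fin_num_fun (povm_diag h).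
Proof. by move=> D _; rewrite povm_diagE. Qed.

HB.instance Definition _ h := @Measure_isFinite.Build _ _ _
  (povm_diag h) (povm_diag_fin h).

Lemma povm_diag_mass h : fine (povm_diag h setT) = sqn h.
Proof. by rewrite povm_diagE /= povmT. Qed.

Lemma povm_diag_representable (D : set (borel_at x0)) :
  representable (fun h => fine (povm_diag h D)).
Proof. by exists (A D); exact: povm_represents. Qed.

Lemma povm_diag_polarization (D : set X) g h : rin (A D g) h =
  fine (povm_diag (2^-1%:C%C *: (g + h)) D) -
  fine (povm_diag (2^-1%:C%C *: (g - h)) D).
Proof. exact: (polarization_half (povm_represents D)). Qed.

End povm_measures.
Arguments povm_diag {R X} x0 {H} A h D.

Section povm_integrals.
Context (R : realType) (X : topologicalType) (H : hilbertType R).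
Variable A : povm X H.
Variable Xne : exists x : X, True.

(* [cintegral] integrates over the Borel space pointed at this point. *)
Local Notation x0 := (projT1 (cid Xne)).
Local Notation mu := (povm_diag x0 A).

(** The charges Re <A(.) g, h> and Im <A(.) g, h> = Re <A(.) g, i h> are
    differences of two diagonal measures, by [povm_diag_polarization]. *)
Lemma cintegral_povm_measure (f : borel_at x0 -> R) g h : bounded_measurable f ->
  cintegral (povm_measure A g h) f = Complex
   (\int[mu (2^-1%:C%C *: (g + h))]_x f x -
    \int[mu (2^-1%:C%C *: (g - h))]_x f x)
   (\int[mu (2^-1%:C%C *: (g + 'i%C *: h))]_x f x -
    \int[mu (2^-1%:C%C *: (g - 'i%C *: h))]_x f x).
Proof.
move=> bf; rewrite /cintegral; case: pselect => [Xne'|//].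
rewrite (Prop_irrelevance Xne' Xne); congr Complex;
  apply: charge_integralB => // D mD.
  transitivity ((rin (A D g) h)%:E); first by [].
  by rewrite (povm_diag_polarization x0 A D g h) EFinB.
transitivity ((rin (A D g) ('i%C *: h))%:E).
  by rewrite -Im_inner.
by rewrite (povm_diag_polarization x0 A D g ('i%C *: h)) EFinB.
Qed.

(** An operator with this form exists by [representable_Rintegral]; by
    polarization it satisfies the equation that defines [povm_integral], which
    has a single solution. *)
Lemma povm_integral_represents (f : borel_at x0 -> R) : bounded_measurable f ->
  represents (povm_integral A f) (fun h => \int[mu h]_x f x).
Proof.
move=> bf; have [mf [M fM]] := bf.
have [T TQ] := representable_Rintegral (povm_diag_mass x0 A)
  (fun D _ => povm_diag_representable A D) bf.
have polar g h : rin (T g) h =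
   (\int[mu (2^-1%:C%C *: (g + h))]_x f x -
    \int[mu (2^-1%:C%C *: (g - h))]_x f x).
  exact: (polarization_half TQ).
have Tint : is_povm_integral A f T.
  split=> [|g h]; last by rewrite cintegral_povm_measure// innerE !polar.
  apply: (represents_bounded (c := `|M|) TQ) => // h.
  rewrite -(povm_diag_mass x0 A) Rintegral_le_mass// => x.
  by rewrite (le_trans (fM x))// ler_norm.
have [_ pE] : is_povm_integral A f (povm_integral A f) by apply: xgetI Tint.
suff -> : povm_integral A f = T by [].
apply/funext => g; apply: eq_inner => h.
by rewrite /rin pE -(proj2 Tint).
Qed.

End povm_integrals.

(** * Lipschitz functions on a compact metric space *)

Section lipschitz_functions.
Context (R : realType) (X : metricType R).
Implicit Types f g : X -> R.

Definition lipschitz_fun f : Prop :=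
  exists k : R, forall x y, `|f x - f y| <= k * mdist x y.

Lemma lipschitz_cst (c : R) : lipschitz_fun (cst c).
Proof. by exists 0 => x y; rewrite subrr normr0 mul0r. Qed.

Lemma lipschitzD f g : lipschitz_fun f -> lipschitz_fun g ->
  lipschitz_fun (fun x => f x + g x).
Proof.
move=> [k fk] [l gl]; exists (k + l) => x y.
rewrite opprD addrACA (le_trans (ler_normD _ _))// mulrDl.
exact: lerD.
Qed.

Lemma lipschitzZ (c : R) f : lipschitz_fun f -> lipschitz_fun (fun x => c * f x).
Proof.
move=> [k fk]; exists (`|c| * k) => x y.
by rewrite -mulrBr normrM -mulrA ler_wpM2l.
Qed.

Lemma lipschitzB f g : lipschitz_fun f -> lipschitz_fun g ->
  lipschitz_fun (fun x => f x - g x).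
Proof.
move=> lf lg; have := lipschitzD lf (lipschitzZ (-1) lg).
by under eq_fun do rewrite mulN1r.
Qed.

Lemma lipschitz_min (c : R) f : lipschitz_fun f ->
  lipschitz_fun (fun x => Num.min (f x) c).
Proof.
move=> [k fk]; exists k => x y; rewrite (le_trans _ (fk x y))//.
have := ler_norm (f x - f y); have := ler_norm (- (f x - f y)); rewrite normrN.
rewrite ler_norml; case: (leP (f x) c); case: (leP (f y) c);
  move=> *; apply/andP; split; lra.
Qed.

Lemma lipschitz_sum (I : Type) (s : seq I) (F : I -> X -> R) :
  (forall i, lipschitz_fun (F i)) -> lipschitz_fun (fun x => \sum_(i <- s) F i x).
Proof.
move=> lF; elim: s => [|i s ih].
  by under eq_fun do rewrite big_nil; exact: lipschitz_cst.
by under eq_fun do rewrite big_cons; exact: lipschitzD.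
Qed.

Lemma lipschitz_continuous f : lipschitz_fun f -> continuous f.
Proof.
move=> [k fk] x; apply/cvgrPdist_lt => e e0.
have k0 : 0 < `|k| + 1 by rewrite ltr_wpDl.
have d0 : 0 < e / (`|k| + 1) by rewrite divr_gt0.
have := nbhsx_ballx x _ d0; apply: filterS => y.
rewrite ballEmdist /= ltr_pdivlMr// mulrC => xy.
rewrite (le_lt_trans (fk x y))// (le_lt_trans _ xy)// ler_wpM2r ?mdist_ge0//.
by rewrite (le_trans (ler_norm k))// lerDl.
Qed.

Lemma lipschitz_measurable (x0 : X) f : lipschitz_fun f ->
  measurable_fun (setT : set (borel_at x0)) (f : borel_at x0 -> R).
Proof.
move=> /lipschitz_continuous/continuousP cf.
move=> mT; apply: (measurability _ (RGenOpens.measurableE R)) => //.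
move=> _ [_ [a [b ->] <-]]; rewrite setTI.
by apply: sub_sigma_algebra; apply: cf; exact: interval_open.
Qed.

Hypothesis compactX : compact [set: X].

(** Compactness is used in this form only. *)
Lemma compact_nondecreasing_cover (V : (set X)^nat) :
  (forall n, open (V n)) -> nondecreasing_seq V ->
  (forall x, exists n, V n x) ->
  exists n, forall x, V n x.
Proof.
move=> oV ndV VX.
have /compact_near_coveringP cov := compactX.
have [x _|N _ VN] := cov nat \oo (fun n x => V n x).
- have [n Vx] := VX x.
  exists (V n, [set m | (n <= m)%N]) => /=.
    by split; [exact: open_nbhs_nbhs|exists n].
  move=> [y m] /= [Vy nm]; have /subsetPset := ndV n m nm; exact.
- by exists N => x; exact: (VN N (leqnn N) x I).
Qed.

Lemma lipschitz_bounded f : lipschitz_fun f ->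
  exists M : R, forall x, `|f x| <= M.
Proof.
move=> lf; have cf := lipschitz_continuous lf.
have [|m n mn||n fn] :=
    @compact_nondecreasing_cover (fun n => [set x | `|f x| < n%:R]).
- move=> n; apply: (@open_comp _ _ (fun x => `|f x|) [set r | r < n%:R]) => //.
  by move=> x _; exact: (cvg_norm (cf x)).
- by apply/subsetPset => x /= /lt_le_trans; apply; rewrite ler_nat.
- move=> x; exists (Num.bound `|f x|) => /=.
  exact: archi_boundP.
by exists n%:R => x; exact/ltW/fn.
Qed.

Lemma lipschitz_bounded_measurable (x0 : X) f : lipschitz_fun f ->
  bounded_measurable (f : borel_at x0 -> R).
Proof.
by move=> lf; split; [exact: lipschitz_measurable|exact: lipschitz_bounded].
Qed.

Lemma lipschitzM f g : lipschitz_fun f -> lipschitz_fun g ->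
  lipschitz_fun (fun x => f x * g x).
Proof.
move=> lf lg; have [M fM] := lipschitz_bounded lf.
have [N gN] := lipschitz_bounded lg.
have [k fk] := lf; have [l gl] := lg.
exists (M * l + N * k) => x y.
have -> : f x * g x - f y * g y = f x * (g x - g y) + (f x - f y) * g y by ring.
rewrite (le_trans (ler_normD _ _))// !normrM mulrDl -!mulrA lerD//.
  by rewrite ler_pM.
by rewrite mulrC ler_pM.
Qed.

(** Dini's argument: the open sets where g < F n + e increase to X. *)
Lemma dini_le (F : (X -> R)^nat) g (e : R) :
  (forall n, lipschitz_fun (F n)) -> lipschitz_fun g ->
  (forall x, nondecreasing_seq (F^~ x)) ->
  (forall x, exists n, g x <= F n x) -> 0 < e ->
  exists n, forall x, g x <= F n x + e.
Proof.
move=> lF lg Fnd gF e0.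
have [|m n mn||n gn] :=
    @compact_nondecreasing_cover (fun n => [set x | g x - F n x < e]).
- move=> n; have cF := lipschitz_continuous (lipschitzB lg (lF n)).
  by apply: (@open_comp _ _ (fun x => g x - F n x) [set r | r < e]) => //.
- apply/subsetPset => x /=; apply: le_lt_trans.
  by rewrite lerB//; exact: Fnd.
- by move=> x; have [n gFn] := gF x; exists n => /=; lra.
by exists n => x; have := gn x => /=; lra.
Qed.

End lipschitz_functions.
Section lipschitz_approximation.
Context (R : realType) (X : metricType R).
Variable U : set X.
Implicit Types (x y : X) (n : nat).

Let slopes n x : set R := [set \1_U y + n%:R * mdist x y | y in setT].

(** The inf-convolution of \1_U with n d, that is, the largest n-Lipschitz
    function below \1_U; it increases to \1_U when U is open. *)
Definition lip_approx n x : R := inf (slopes n x).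

Let slopes0 n x : slopes n x !=set0.
Proof. by exists (\1_U x + n%:R * mdist x x); exists x. Qed.

Let indic_ge0 y : 0 <= \1_U y :> R.
Proof. by rewrite indicE. Qed.

Let slopes_lb n x : lbound (slopes n x) 0.
Proof. by move=> _ [y _ <-]; rewrite addr_ge0// mulr_ge0// mdist_ge0. Qed.

Let lip_approx_lb n x y : lip_approx n x <= \1_U y + n%:R * mdist x y.
Proof. by apply: ge_inf; [exists 0; exact: slopes_lb|exists y]. Qed.

Lemma lip_approx_ge0 n x : 0 <= lip_approx n x.
Proof. by apply: lb_le_inf => //; exact: slopes_lb. Qed.

Lemma lip_approx_le n x : lip_approx n x <= \1_U x.
Proof. by have := lip_approx_lb n x x; rewrite mdistxx mulr0 addr0. Qed.

Lemma lip_approx_out n x : ~ U x -> lip_approx n x = 0.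
Proof.
move=> nUx; apply/eqP; rewrite eq_le lip_approx_ge0 andbT.
by rewrite (le_trans (lip_approx_le n x))// indicE memNset.
Qed.

Lemma lip_approx_le1 n x : lip_approx n x <= 1.
Proof. by rewrite (le_trans (lip_approx_le n x))// indicE lern1 leq_b1. Qed.

Lemma lip_approx_lipschitz n : lipschitz_fun (lip_approx n).
Proof.
have le x y : lip_approx n x - n%:R * mdist x y <= lip_approx n y.
  apply: lb_le_inf => // _ [z _ <-]; rewrite lerBlDr.
  rewrite (le_trans (lip_approx_lb n x z))// -addrA lerD2l -mulrDr.
  by rewrite ler_wpM2l// addrC metric_triangle.
exists n%:R => x y; have := le x y; have := le y x.
rewrite metric_sym ler_norml.
by move=> *; apply/andP; split; lra.
Qed.

Lemma nondecreasing_lip_approx x : nondecreasing_seq (lip_approx^~ x).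
Proof.
move=> m n mn; apply: lb_le_inf => // _ [y _ <-].
rewrite (le_trans (lip_approx_lb m x y))// lerD2l ler_wpM2r ?mdist_ge0//.
by rewrite ler_nat.
Qed.

Hypothesis oU : open U.

Lemma lip_approx_eq1 x : U x -> exists n, lip_approx n x = 1.
Proof.
move=> Ux; have /nbhs_ballP[e /= e0 xeU] := open_nbhs_nbhs (conj oU Ux).
exists (Num.bound e^-1); apply/eqP; rewrite eq_le lip_approx_le1.
apply: lb_le_inf => // _ [y _ <-].
have [Uy|nUy] := pselect (U y).
  by rewrite indicE mem_set// lerDl mulr_ge0// mdist_ge0.
rewrite indicE memNset// add0r -[leLHS](mulVf (lt0r_neq0 e0)) ler_pM//.
- by rewrite invr_ge0 ltW.
- exact: ltW.
- by rewrite ltW// archi_boundP// invr_ge0 ltW.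
- rewrite leNgt; apply/negP => xy; apply: nUy; apply: xeU.
  by rewrite ballEmdist.
Qed.

Lemma lip_approx_cvg x : lip_approx^~ x @ \oo --> (\1_U x : R).
Proof.
have [Ux|nUx] := pselect (U x).
  have [n nx1] := lip_approx_eq1 Ux.
  rewrite indicE mem_set//; apply: cvg_near_cst; exists n => // m /= nm.
  apply/eqP; rewrite eq_le lip_approx_le1 -nx1.
  exact: nondecreasing_lip_approx.
rewrite indicE memNset//; under eq_fun do rewrite lip_approx_out//.
exact: cvg_cst.
Qed.

Lemma Rintegral_lip_approx_cvg (x0 : X) (compactX : compact [set: X])
    (mu : {finite_measure set (borel_at x0) -> \bar R}) :
  (fun n => \int[mu]_x lip_approx n x) @ \oo --> fine (mu U).
Proof.
have mU : measurable (U : set (borel_at x0)) by exact: sub_sigma_algebra.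
rewrite -(Rintegral_indicT mu mU).
apply: (@Rintegral_cvg_bounded _ _ _ _ _ _ 1).
- by move=> n; apply: lipschitz_measurable; exact: lip_approx_lipschitz.
- by move=> n x; rewrite ger0_norm ?lip_approx_ge0 ?lip_approx_le1.
- exact: lip_approx_cvg.
Qed.

End lipschitz_approximation.

Section kantorovich_distance.
Context (R : realType) (X : metricType R) (H : hilbertType R).
Hypothesis compactX : compact [set: X].
Variable Xne : exists x : X, True.
Local Notation x0 := (projT1 (cid Xne)).
Implicit Types A B : povm X H.

Lemma Lip1_lipschitz (f : X -> R) : Lip1 f -> lipschitz_fun f.
Proof. by move=> f1; exists 1 => x y; rewrite mul1r f1. Qed.

(** From operators to scalar measures: int f dA - int f dB has the form
    h |-> int f dmu^A_h - int f dmu^B_h, and its norm is read off its form. *)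
Lemma kantorovich_leP A B (c : R) : 0 <= c ->
  (kantorovich A B <= c%:E)%E <->
  forall f, Lip1 f -> forall h, `|\int[povm_diag x0 A h]_x f x -
                                 \int[povm_diag x0 B h]_x f x| <= c * sqn h.
Proof.
move=> c0.
have rep f : Lip1 f -> represents (povm_integral A f \- povm_integral B f)
    (fun h => \int[povm_diag x0 A h]_x f x - \int[povm_diag x0 B h]_x f x).
  move=> /Lip1_lipschitz/(lipschitz_bounded_measurable compactX x0) bf.
  by apply: represents_sub; exact: povm_integral_represents.
split=> [ABc f f1|fc].
  apply/(operator_norm_leP (rep f f1) c0).
  by rewrite (le_trans _ ABc)//; apply: ereal_sup_ubound; exists f.
apply: ub_ereal_sup => _ [f f1 <-].
by apply/(operator_norm_leP (rep f f1) c0) => h; exact: fc.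
Qed.

End kantorovich_distance.

(** * The Riesz-Markov theorem for Lipschitz functions *)

(** The domain consists of the Lipschitz functions instead of the continuous
    ones because the integrals of Lipschitz functions are what Kantorovich
    convergence controls. On a compact space they are stable under products,
    besides sums and truncation, which suffices to build a measure. *)
Record positive_functional (R : realType) (X : metricType R) :=
    PositiveFunctional {
  functional :> (X -> R) -> R ;
  functionalD : forall f g, lipschitz_fun f -> lipschitz_fun g ->
    functional (fun x => f x + g x) = functional f + functional g ;
  functionalZ : forall (c : R) f, lipschitz_fun f ->
    functional (fun x => c * f x) = c * functional f ;
  functional_ge0 : forall f, lipschitz_fun f -> (forall x, 0 <= f x) ->
    0 <= functional f }.

Section riesz_content.
Context (R : realType) (X : metricType R) (L : positive_functional X).
Implicit Types (f g : X -> R) (E U : set X) (F : (X -> R)^nat).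

Lemma functionalB f g : lipschitz_fun f -> lipschitz_fun g ->
  L (fun x => f x - g x) = L f - L g.
Proof.
move=> lf lg; have := functionalD L lf (lipschitzZ (-1) lg).
by rewrite functionalZ// mulN1r; under eq_fun do rewrite mulN1r.
Qed.

Lemma le_functional f g : lipschitz_fun f -> lipschitz_fun g ->
  (forall x, f x <= g x) -> L f <= L g.
Proof.
move=> lf lg fg; rewrite -subr_ge0 -functionalB//.
by apply: functional_ge0 => [|x]; [exact: lipschitzB|rewrite subr_ge0].
Qed.

Lemma functional_cst (c : R) : L (cst c) = c * L (cst 1).
Proof.
rewrite -functionalZ; last exact: lipschitz_cst.
by congr (L _); apply/funext => x /=; rewrite mulr1.
Qed.

Lemma functional_sum n (F : (X -> R)^nat) : (forall i, lipschitz_fun (F i)) ->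
  L (fun x => \sum_(0 <= i < n) F i x) = \sum_(0 <= i < n) L (F i).
Proof.
move=> lF; elim: n => [|n ih].
  rewrite big_nil; under eq_fun do rewrite big_nil.
  by rewrite (functional_cst 0) mul0r.
rewrite big_nat_recr//= -ih -functionalD//; last exact: lipschitz_sum.
by congr (L _); apply/funext => x; rewrite big_nat_recr.
Qed.

(** Coverings are increasing sequences rather than series of functions: the
    cost sup_n L (F n) then needs no summation, and countably many coverings
    are merged without double series. *)
Definition covering F E : Prop :=
  [/\ forall n, lipschitz_fun (F n), forall n x, 0 <= F n x,
      forall x, nondecreasing_seq (F^~ x) &
      forall x, E x -> exists n, 1 <= F n x].

Definition costs E : set R :=
  [set c | exists2 F, covering F E & forall n, L (F n) <= c].

Definition riesz_content E : R := inf (costs E).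

Lemma functional1_ge0 : 0 <= L (cst 1).
Proof.
by apply: functional_ge0 => [|x]; [exact: lipschitz_cst|exact: ler01].
Qed.

Lemma costs_total E : costs E (L (cst 1)).
Proof.
exists (fun=> cst 1) => //; split=> //.
- by move=> n; exact: lipschitz_cst.
- by move=> x m n mn.
- by move=> x _; exists 0%N.
Qed.

Lemma costs_lb E : lbound (costs E) 0.
Proof.
move=> c [F [lF F0 _ _] Fc]; rewrite (le_trans _ (Fc 0%N))//.
exact: functional_ge0.
Qed.

Lemma riesz_content_le E c : costs E c -> riesz_content E <= c.
Proof. by move=> Ec; apply: ge_inf => //; exists 0; exact: costs_lb. Qed.

Lemma riesz_content_ge0 E : 0 <= riesz_content E.
Proof.
by apply: lb_le_inf; [exists (L (cst 1)); exact: costs_total|exact: costs_lb].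
Qed.

Lemma riesz_content_ge E (r : R) :
  (forall F c, covering F E -> (forall n, L (F n) <= c) -> r <= c) ->
  r <= riesz_content E.
Proof.
move=> h; apply: lb_le_inf; first by exists (L (cst 1)); exact: costs_total.
by move=> c [F FE Fc]; exact: h FE Fc.
Qed.

Lemma riesz_content_approx E (e : R) : 0 < e ->
  exists2 F, covering F E & forall n, L (F n) <= riesz_content E + e.
Proof.
move=> e0; have hE : has_inf (costs E).
  by split; [exists (L (cst 1)); exact: costs_total|exists 0; exact: costs_lb].
have [c [F FE Fc] ce] := inf_adherent e0 hE.
by exists F => // n; rewrite (le_trans (Fc n))// ltW.
Qed.

Definition riesz_outer E : \bar R := (riesz_content E)%:E.

Lemma riesz_outer0 : riesz_outer set0 = 0%E.
Proof.
congr EFin; apply/eqP; rewrite eq_le riesz_content_ge0 andbT.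
apply: riesz_content_le; exists (fun=> cst 0); last first.
  by move=> _; rewrite functional_cst mul0r.
split=> // [n|x m n mn]; [exact: lipschitz_cst|exact: lexx].
Qed.

Lemma riesz_outer_ge0 E : (0 <= riesz_outer E)%E.
Proof. by rewrite lee_fin riesz_content_ge0. Qed.

Lemma le_riesz_outer : {homo riesz_outer : E E' / E `<=` E' >-> (E <= E')%E}.
Proof.
move=> E E' EE'; rewrite lee_fin; apply: riesz_content_ge => F c [lF F0 Fnd FE] Fc.
by apply: riesz_content_le; exists F => //; split=> // x /EE'/FE.
Qed.

(** Coverings F i of E i at cost within e / 2^(i+1) are merged diagonally: the
    n-th function is the sum of the F i n for i < n. *)
Lemma riesz_outer_sigma_subadditive : sigma_subadditive riesz_outer.
Proof.
move=> E; set S := (X in (_ <= X)%E).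
have S0 : (0 <= S)%E by apply: nneseries_ge0 => n _ _; exact: riesz_outer_ge0.
case SE : S S0 => [s| |//] _; last exact: leey.
rewrite lee_fin; apply/ler_addgt0Pr => e e0.
have ei0 i : 0 < e / (2 ^ i.+1)%:R by rewrite divr_gt0// ltr0n expn_gt0.
have /choice[F FE] i : exists F, covering F (E i) /\
    forall n, L (F n) <= riesz_content (E i) + e / (2 ^ i.+1)%:R.
  by have [F] := riesz_content_approx (E i) (ei0 i); exists F.
have lF i n : lipschitz_fun (F i n) by have [[]] := FE i.
have F0 i n x : 0 <= F i n x by have [[]] := FE i.
have Fnd i x : nondecreasing_seq ((F i)^~ x) by have [[]] := FE i.
pose G n x := \sum_(0 <= i < n) F i n x.
have GF n i x : (i < n)%N -> F i n x <= G n x.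
  move=> ilen; rewrite /G (bigD1_seq i) ?iota_uniq ?mem_index_iota//=.
  by rewrite lerDl sumr_ge0.
apply: riesz_content_le; exists G.
  split=> [n|n x|x|x [i _ Eix]].
  - exact: lipschitz_sum.
  - exact: sumr_ge0.
  - apply/nondecreasing_seqP => n; rewrite /G big_nat_recr//= ler_wpDr//.
    by apply: ler_sum => i _; exact: Fnd.
  - have [[_ _ _ /(_ x Eix)[n Fn1]] _] := FE i.
    exists (maxn n i.+1); rewrite (le_trans _ (GF _ i x _)) ?leq_maxr//.
    by rewrite (le_trans Fn1)// Fnd// leq_maxl.
move=> n; rewrite functional_sum//.
apply: (@le_trans _ _
    (\sum_(0 <= i < n) (riesz_content (E i) + e / (2 ^ i.+1)%:R))).
  by apply: ler_sum => i _; have [_ ->] := FE i.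
rewrite -lee_fin EFinD -SE -sumEFin.
apply: le_trans (epsilon_trick xpredT (fun i => riesz_outer_ge0 (E i)) (ltW e0)).
under eq_bigr do rewrite EFinD.
apply: nneseries_lim_ge => i _ _.
by rewrite adde_ge0 ?riesz_outer_ge0// lee_fin ltW.
Qed.

End riesz_content.
HB.instance Definition _ (R : realType) (X : metricType R)
  (L : positive_functional X) := isOuterMeasure.Build R X (riesz_outer L)
    (riesz_outer0 L) (riesz_outer_ge0 L) (@le_riesz_outer R X L)
    (@riesz_outer_sigma_subadditive R X L).

Section riesz_measure.
Context (R : realType) (X : metricType R).
Variable compactX : compact [set: X].
Implicit Types (L : positive_functional X) (E U : set X).

(** A covering F of E dominates g in the limit, so by Dini it dominates g - e
    at a finite stage. *)
Lemma functional_le_content L (g : X -> R) E : lipschitz_fun g ->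
  (forall x, E x -> g x <= 1) -> (forall x, ~ E x -> g x <= 0) ->
  L g <= riesz_content L E.
Proof.
move=> lg gE gnE; apply: riesz_content_ge => F c [lF F0 Fnd FE] Fc.
have L1 : 0 < L (cst 1) + 1 by rewrite ltr_wpDl// functional1_ge0.
apply/ler_addgt0Pr => e e0.
have e0' : 0 < e / (L (cst 1) + 1) by rewrite divr_gt0.
have [|n gFn] := dini_le compactX lF lg Fnd _ e0'.
  move=> x; have [Ex|nEx] := pselect (E x).
    by have [n Fn1] := FE x Ex; exists n; rewrite (le_trans (gE x Ex)).
  by exists 0%N; rewrite (le_trans (gnE x nEx)).
have le := lipschitz_cst X (e / (L (cst 1) + 1)).
rewrite (le_trans (le_functional L lg (lipschitzD (lF n) le) gFn))//.
rewrite functionalD// functional_cst lerD// -mulrA ler_piMr ?(ltW e0)//.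
by rewrite mulrC ler_pdivrMr// mul1r lerDl.
Qed.

Lemma riesz_content_total L : riesz_content L setT = L (cst 1).
Proof.
apply/eqP; rewrite eq_le riesz_content_le/=; last exact: costs_total.
by apply: functional_le_content => [|x _|x /(_ I)//];
  [exact: lipschitz_cst|exact: lexx].
Qed.

(** Let the Lipschitz functions g n increase to \1_U, and let F cover E. Then
    F n * g n covers the part of E inside U, and F n * (1 - g N) the part
    outside, for any fixed N. If L (F N * g N) is within e of the supremum of
    the L (F n * g n), then the two costs add up to at most the cost of F plus
    e. *)
Lemma caratheodory_open L U : open U -> (riesz_outer L).-caratheodory U.
Proof.
move=> oU; apply: le_caratheodory_measurable => E.
rewrite -EFinD lee_fin; apply: riesz_content_ge => F c [lF F0 Fnd FE] Fc.
apply/ler_addgt0Pr => e e0.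
pose g := @lip_approx R X U.
have lg n : lipschitz_fun (g n) by exact: lip_approx_lipschitz.
have lFg n m := lipschitzM compactX (lF n) (lg m).
have lcg m := lipschitzB (lipschitz_cst X 1) (lg m).
have lFcg n m := lipschitzM compactX (lF n) (lcg m).
pose a n := L (fun x => F n x * g n x).
have ac n : a n <= c.
  rewrite (le_trans _ (Fc n))//; apply: le_functional => // x.
  by rewrite ler_piMr// lip_approx_le1.
have ha : has_sup (range a).
  by split; [exists (a 0%N); exists 0%N|exists c => _ [n _ <-]].
have [_ [N _ <-] aN] := sup_adherent e0 ha.
have EU : riesz_content L (E `&` U) <= sup (range a).
  apply: riesz_content_le; exists (fun n x => F n x * g n x); last first.
    by move=> n; apply: sup_upper_bound => //; exists n.
  split=> // [n x|x m n mn|x [/FE[n Fn1] /(lip_approx_eq1 oU)[m gm1]]].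
  - by rewrite mulr_ge0// lip_approx_ge0.
  - by rewrite ler_pM ?lip_approx_ge0//;
      [exact: Fnd|exact: nondecreasing_lip_approx].
  - exists (maxn n m); rewrite -[leLHS]mulr1 ler_pM//.
      by rewrite (le_trans Fn1)// Fnd// leq_maxl.
    by rewrite -gm1 nondecreasing_lip_approx// leq_maxr.
have EnU : riesz_content L (E `&` ~` U) <= c - sup (range a) + e.
  apply: riesz_content_le; exists (fun n x => F n x * (1 - g N x)).
    split=> // [n x|x m n mn|x [/FE[n Fn1] nUx]].
    - by rewrite mulr_ge0// subr_ge0 lip_approx_le1.
    - by rewrite ler_wpM2r ?subr_ge0 ?lip_approx_le1//; exact: Fnd.
    - by exists n; rewrite /g lip_approx_out// subr0 mulr1.
  move=> n.
  pose m := maxn n N.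
  have FnFm : L (fun x => F n x * (1 - g N x)) <=
              L (fun x => F m x * (1 - g N x)).
    apply: le_functional => // x; rewrite ler_wpM2r ?subr_ge0 ?lip_approx_le1//.
    by rewrite Fnd// leq_maxl.
  have aNm : a N <= L (fun x => F m x * g N x).
    apply: le_functional => // x; rewrite ler_wpM2r ?lip_approx_ge0//.
    by rewrite Fnd// leq_maxr.
  have E1 : L (fun x => F m x * (1 - g N x)) =
            L (F m) - L (fun x => F m x * g N x).
    rewrite -functionalB//; congr (L _); apply/funext => x; ring.
  have := Fc m; lra.
lra.
Qed.

Let sub_caratheodory L : @borel X `<=` (riesz_outer L).-caratheodory.
Proof.
apply: smallest_sub => [|U oU]; last exact: caratheodory_open.
split=> [|A|F].
- exact: caratheodory_measurable_set0.
- by rewrite setTD; exact: caratheodory_measurable_setC.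
- exact: caratheodory_measurable_bigcup.
Qed.

(** The compactness argument is kept in the term since the sigma-additivity on
    Borel sets, hence the measure structure, depends on it. *)
Definition riesz_measure (x0 : X) & compact [set: X] :=
  fun L => riesz_outer L : set (borel_at x0) -> \bar R.

Arguments riesz_measure : clear implicits.

Variables (x0 : X) (L : positive_functional X).

Let mu0 : riesz_measure x0 compactX L set0 = 0%E.
Proof. exact: riesz_outer0. Qed.

Let mu_ge0 D : (0 <= riesz_measure x0 compactX L D)%E.
Proof. exact: riesz_outer_ge0. Qed.

Let mu_sigma_additive : semi_sigma_additive (riesz_measure x0 compactX L).
Proof.
move=> F mF tF mUF.
apply: (@caratheodory_measure_sigma_additive R (pointed_at x0) (riesz_outer L)) => //.
  by move=> n; have := @sub_caratheodory L (F n) (mF n).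
by have := @sub_caratheodory L _ mUF.
Qed.

HB.instance Definition _ := isMeasure.Build _ _ _
  (riesz_measure x0 compactX L) mu0 mu_ge0 mu_sigma_additive.

Let mu_fin : fin_num_fun (riesz_measure x0 compactX L).
Proof. by []. Qed.

HB.instance Definition _ := @Measure_isFinite.Build _ _ _
  (riesz_measure x0 compactX L) mu_fin.

Local Notation mu := (riesz_measure x0 compactX L).

Let riesz_mass : fine (mu setT) = L (cst 1).
Proof. exact: riesz_content_total. Qed.

(** Cut f at the heights i d. A slice above the height i d, for i > 0, is at
    most d and lives on [f > i d], so that L of it is at most d mu(f > i d); the
    slice just below equals d on that set, so its integral is at least
    d mu(f > i d). Comparing each slice with the one below it loses only the
    lowest slice, which contributes at most d L(1). *)
Let le_Rintegral_riesz (f : X -> R) : lipschitz_fun f ->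
  (forall x, 0 <= f x <= 1) -> L f <= \int[mu]_x f x.
Proof.
move=> lf f01; apply/ler_addgt0Pr => e e0.
(* the height d = 1 / (N + 1) of the slices is such that d L(1) <= e *)
pose N := Num.bound (L (cst 1) / e).
pose d : R := N.+1%:R^-1.
have d0 : 0 < d by rewrite invr_gt0.
have dN : N.+1%:R * d = 1 by rewrite mulfV.
pose cut i x := Num.min (f x) (i%:R * d).
have lcut i : lipschitz_fun (cut i) by exact: lipschitz_min.
have bm g : lipschitz_fun g -> bounded_measurable (g : borel_at x0 -> R).
  exact: lipschitz_bounded_measurable.
have layers i : L (cut i.+1) <= \int[mu]_x cut i x + d * L (cst 1).
  elim: i => [|i ih].
    rewrite (@le_trans _ _ (d * L (cst 1)))//.
      rewrite -functional_cst; apply: le_functional => // [|x].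
        exact: lipschitz_cst.
      by rewrite /cut mul1r ge_min lexx orbT.
    rewrite lerDr; apply: Rintegral_ge0 => x _.
    by rewrite /cut mul0r le_min lexx andbT; have /andP[] := f01 x.
  pose t := i.+1%:R * d.
  pose E := [set x | t < f x].
  have mE : measurable (E : set (borel_at x0)).
    apply: sub_sigma_algebra.
    have := lipschitz_continuous lf; move=> /continuousP/(_ [set r | t < r]).
    by apply; exact: open_gt.
  have tS : i.+2%:R * d = t + d by rewrite /t -[in LHS]natr1 mulrDl mul1r.
  have tP : t = i%:R * d + d by rewrite /t -natr1 mulrDl mul1r.
  have ld := lipschitzB (lcut i.+2) (lcut i.+1).
  have ld' := lipschitzB (lcut i.+1) (lcut i).
  have Ld : L (fun x => cut i.+2 x - cut i.+1 x) <= d * fine (mu E).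
    rewrite -ler_pdivrMl// -functionalZ//.
    apply: functional_le_content => //; first exact: lipschitzZ.
      move=> x _; rewrite ler_pdivrMl// mulr1 /cut tS -/t.
      by case: (leP (f x) t); case: (leP (f x) (t + d)); lra.
    move=> x /negP; rewrite -leNgt => ft.
    rewrite ler_pdivrMl// mulr0 /cut tS -/t.
    by case: (leP (f x) t) ft; case: (leP (f x) (t + d)); lra.
  have Id : d * fine (mu E) <= \int[mu]_x cut i.+1 x - \int[mu]_x cut i x.
    rewrite -(Rintegral_indicT _ mE) -RintegralZ_bounded; last first.
      exact: bounded_measurable_indic.
    rewrite -RintegralB//; [|exact: bounded_integrable (bm _ _)..].
    apply: le_Rintegral_bounded.
    - exact/bounded_measurableZ/bounded_measurable_indic.
    - exact: bm.
    - move=> x; rewrite indicE /cut -/t; have [xE|xE] := pselect (E x).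
        rewrite mem_set//=; move: xE; rewrite /E /=.
        by case: (leP (f x) t); case: (leP (f x) (i%:R * d)); lra.
      rewrite memNset//=; case: (leP (f x) t); case: (leP (f x) (i%:R * d)); lra.
  rewrite -(subrK (L (cut i.+1)) (L (cut i.+2))) -functionalB//.
  by rewrite (le_trans (lerD (le_trans Ld Id) ih))// addrA subrK.
have cutf i : (N < i)%N -> cut i = f.
  move=> Ni; apply/funext => x; rewrite /cut min_l//.
  have /andP[_ fx1] := f01 x; rewrite (le_trans fx1)// -[leLHS]dN ler_wpM2r//.
    exact: ltW.
  by rewrite ler_nat.
have := layers N.+1; rewrite !cutf// => Lf; rewrite (le_trans Lf)// lerD2l.
rewrite mulrC ler_pdivrMr// mulrC -ler_pdivrMr//.
rewrite (@le_trans _ _ N%:R)//; last by rewrite ler_nat.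
by rewrite ltW// archi_boundP// divr_ge0 ?functional1_ge0// ltW.
Qed.

(** For values in [0, 1], the inequality [le_Rintegral_riesz] for f and for
    1 - f gives the equality; an affine change of scale does the rest. *)
Lemma Rintegral_riesz_measure (f : X -> R) : lipschitz_fun f ->
  \int[mu]_x f x = L f.
Proof.
move=> lf; have bm g : lipschitz_fun g -> bounded_measurable (g : borel_at x0 -> R).
  exact: lipschitz_bounded_measurable.
have eq01 g : lipschitz_fun g -> (forall x, 0 <= g x <= 1) ->
    \int[mu]_x g x = L g.
  move=> lg g01; apply/eqP; rewrite eq_le le_Rintegral_riesz// andbT.
  have l1 := lipschitz_cst X (1 : R).
  have := @le_Rintegral_riesz (fun x => 1 - g x) (lipschitzB l1 lg) _.
  rewrite functionalB// RintegralB//; [|exact: bounded_integrable (bm _ _)..].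
  rewrite Rintegral_cst// mul1r riesz_mass lerD2l lerN2; apply => x.
  by have := g01 x; lra.
have [M0 fM0] := lipschitz_bounded compactX lf.
pose M := `|M0| + 1.
have M_gt0 : 0 < M by rewrite ltr_wpDl.
have fM x : `|f x| <= M by rewrite (le_trans (fM0 x))// ler_wpDr// ler_norm.
pose g x := (2 * M)^-1 * (f x + M).
have lfM : lipschitz_fun (fun x => f x + M) := lipschitzD lf (lipschitz_cst X M).
have lg : lipschitz_fun g by exact: lipschitzZ.
have g01 x : 0 <= g x <= 1.
  have := fM x; rewrite ler_norml => /andP[f1 f2]; apply/andP; split.
    by rewrite mulr_ge0 ?invr_ge0; lra.
  by rewrite ler_pdivrMl ?mulr1; lra.
have fE : f = fun x => 2 * M * g x + (- M).
  by apply/funext => x; rewrite /g; field; rewrite gt_eqF.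
have l2 := lipschitzZ (2 * M) lg.
have lM := lipschitz_cst X (- M).
transitivity (2 * M * L g + - M * L (cst 1)); last first.
  by rewrite -functionalZ// -functional_cst -(functionalD _ l2 lM) -fE.
rewrite [X in Rintegral _ _ X]fE.
rewrite (RintegralD_bounded mu (bm _ l2) (bm _ lM)).
rewrite (RintegralZ_bounded mu _ (bm _ lg)) eq01//.
by rewrite Rintegral_cst// riesz_mass.
Qed.

End riesz_measure.
Arguments riesz_measure {R X} x0 _ L _.

(** * A POVM from a family of scalar measures *)

Lemma cvg_complex (R : realType) (u : R[i]^nat) (l : R[i]) :
  (fun n => complex.Re (u n)) @ \oo --> complex.Re l ->
  (fun n => complex.Im (u n)) @ \oo --> complex.Im l ->
  (fun n => u n : R[i]^o) @ \oo --> (l : R[i]^o).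
Proof.
move=> /cvgrPdist_lt ure /cvgrPdist_lt uim; apply/cvgrPdist_lt => e e0.
have eE := gt0_complexE e0.
have e20 : 0 < complex.Re e / 2 by rewrite divr_gt0// -ltcR -eE.
apply: filterS2 (ure _ e20) (uim _ e20) => n ren imn.
rewrite eE normc_def ltcR.
have -> : complex.Re (l - u n) = complex.Re l - complex.Re (u n).
  by case: l (u n) {ure uim ren imn} => ? ? [].
have -> : complex.Im (l - u n) = complex.Im l - complex.Im (u n).
  by case: l (u n) {ure uim ren imn} => ? ? [].
move: ren imn; set a := _ - _; set b := _ - _ => ren imn.
rewrite (@le_lt_trans _ _ (`|a| + `|b|))//; last by lra.
rewrite -[leRHS]ger0_norm ?addr_ge0// -sqrtr_sqr ler_sqrt ?sqr_ge0//.
rewrite -(real_normK (num_real a)) -(real_normK (num_real b)) sqrrD.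
by rewrite lerD2r lerDl mulrn_wge0// mulr_ge0.
Qed.

Section povm_of_measures.
Context (R : realType) (X : metricType R) (x0 : X) (H : hilbertType R).
Hypothesis compactX : compact [set: X].
Variable mu : H -> {finite_measure set (borel_at x0) -> \bar R}.
Hypothesis mu_mass : forall h, fine (mu h setT) = sqn h.
Hypothesis mu_rep : forall f, lipschitz_fun f ->
  representable (fun h => \int[mu h]_x f x).

Let mass_ge0 h (D : set (borel_at x0)) : 0 <= fine (mu h D).
Proof. exact: fine_ge0. Qed.

Let mass_le h (D : set (borel_at x0)) :
  measurable D -> fine (mu h D) <= sqn h.
Proof.
by move=> mD; rewrite -mu_mass fine_le ?fin_num_measure// le_measure ?inE.
Qed.

Let mass_cvg h (F : (set (borel_at x0))^nat) :
  (forall n, measurable (F n)) -> trivIset setT F ->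
  (fun n => \sum_(0 <= i < n) fine (mu h (F i))) @ \oo
    --> fine (mu h (\bigcup_n F n)).
Proof.
move=> mF tF.
have mUF : measurable (\bigcup_n F n) by exact: bigcupT_measurable.
have muF : (fun n => \sum_(0 <= i < n) mu h (F i))%E @ \oo
    --> (fine (mu h (\bigcup_n F n)))%:E.
  rewrite fineK ?fin_num_measure//.
  exact: (@measure_semi_sigma_additive _ _ _ (mu h) F mF tF mUF).
rewrite (_ : (fun n => _) = fine \o (fun n => \sum_(0 <= i < n) mu h (F i))%E).
  exact: fine_cvg muF.
by apply/funext => n /=; rewrite sum_fine// => i _; rewrite fin_num_measure.
Qed.

(** Dynkin's pi-lambda theorem: the sets with a representable measure contain
    the open sets, by an increasing limit of Lipschitz functions, and are stable
    under complements (|h|^2 is the form of the identity) and countable disjoint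
    unions (an increasing limit of partial sums). *)
Lemma representable_measure (D : set (borel_at x0)) : measurable D ->
  representable (fun h => fine (mu h D)).
Proof.
apply: (@dynkin_induction _ (borel_at x0) (@open X)
  (fun D => representable (fun h => fine (mu h D)))) => //.
- by move=> U V; exact: openI.
- exists id; rewrite (_ : (fun h => _) = @sqn R H); first exact: represents_id.
  by apply/funext => h; rewrite mu_mass.
- move=> U oU.
  have bU n :=
    lipschitz_bounded_measurable compactX x0 (lip_approx_lipschitz U n).
  apply: (@representable_nondecreasing _ _
      (fun n h => \int[mu h]_x lip_approx U n x) _ 1) => //.
  + by move=> n; exact/mu_rep/lip_approx_lipschitz.
  + move=> n h; apply/andP; split.
      by apply: Rintegral_ge0 => x _; exact: lip_approx_ge0.
    rewrite -mu_mass (le_trans (ler_norm _))// Rintegral_le_mass// => x.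
    by rewrite ger0_norm ?lip_approx_ge0// lip_approx_le1.
  + move=> h m n mn; apply: le_Rintegral_bounded => // x.
    exact: nondecreasing_lip_approx.
  + by move=> h; exact: Rintegral_lip_approx_cvg.
- move=> S mS [T TS]; exists (id \- T).
  rewrite (_ : (fun h => _) = fun h => sqn h - fine (mu h S)).
    exact: represents_sub (represents_id H) TS.
  apply/funext => h; rewrite -mu_mass -setTD measureD ?setTI//.
    by rewrite fineB ?fin_num_measure.
  by rewrite -ge0_fin_numE ?fin_num_measure.
- move=> F mF tF rF.
  apply: (@representable_nondecreasing _ _
      (fun n h => \sum_(0 <= i < n) fine (mu h (F i))) _ 1) => //.
  + elim=> [|n [T TS]].
      exists (fun=> 0); rewrite (_ : (fun h => _) = fun=> 0).
        exact: represents_zero.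
      by apply/funext => h; rewrite big_nil.
    have [T' TS'] := rF n; exists (fun h => T h + T' h).
    rewrite (_ : (fun h => _) = fun h =>
        \sum_(0 <= i < n) fine (mu h (F i)) + fine (mu h (F n))).
      exact: represents_add.
    by apply/funext => h; rewrite big_nat_recr.
  + move=> n h; rewrite sumr_ge0//= mul1r.
    have cv := cvg_lim (@norm_hausdorff _ _) (@mass_cvg h _ mF tF).
    have mUF : measurable (\bigcup_n F n) by exact: bigcupT_measurable.
    apply: le_trans (mass_le h mUF); rewrite -cv.
    apply: (@nondecreasing_cvgn_le _
        (fun n => \sum_(0 <= i < n) fine (mu h (F i)))).
      by apply/nondecreasing_seqP => k; rewrite big_nat_recr//= lerDl.
    by apply/cvg_ex; exists (fine (mu h (\bigcup_n F n))); exact: mass_cvg.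
  + by move=> h; apply/nondecreasing_seqP => k; rewrite big_nat_recr//= lerDl.
  + by move=> h; exact: mass_cvg.
Qed.

Section assembly.
Variable B : set X -> H -> H.
Hypothesis B_represents : forall D : set X, borel D ->
  represents (B D) (fun h => fine (mu h (D : set (borel_at x0)))).
Hypothesis B_out : forall D, ~ borel D -> B D = fun=> 0.

Let B_positive D : borel D -> positive_operator (B D).
Proof.
move=> bD; have BD := B_represents bD; split.
  apply: (represents_bounded (c := 1) BD) => // h.
  by rewrite mul1r ger0_norm// mass_le.
by move=> h; case: BD => _ ->; rewrite ler0c.
Qed.

Let B0 : B set0 = fun=> 0.
Proof.
have b0 : @borel X set0 by exact: (@measurable0 _ (borel_at x0)).
apply: (eq_represents (B_represents b0)).
rewrite (_ : (fun h => _) = fun=> 0); first exact: represents_zero.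
by apply/funext => h; rewrite measure0.
Qed.

Let BT : B setT = id.
Proof.
have bT : @borel X setT by exact: (@measurableT _ (borel_at x0)).
apply: (eq_represents (B_represents bT)).
rewrite (_ : (fun h => _) = @sqn R H); first exact: represents_id.
by apply/funext => h; exact: mu_mass.
Qed.

Let B_polarization D g h : borel D -> rin (B D g) h =
  fine (mu (2^-1%:C%C *: (g + h)) (D : set (borel_at x0))) -
  fine (mu (2^-1%:C%C *: (g - h)) (D : set (borel_at x0))).
Proof. by move=> bD; exact: (polarization_half (B_represents bD)). Qed.

(** By polarization <B(D) g, h> is a combination of four values mu_k(D), each of
    them sigma-additive in D. *)
Let B_sigma_additive (F : (set X)^nat) :
  (forall n, borel (F n)) -> trivIset setT F -> forall g h : H,
  (fun n => \sum_(0 <= i < n) inner (B (F i) g) h : R[i]^o) @ \oo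
    --> (inner (B (\bigcup_n F n) g) h : R[i]^o).
Proof.
move=> bF tF g h.
have bUF : borel (\bigcup_n F n) by exact: (@bigcupT_measurable _ (borel_at x0)).
have rin_cvg k : (fun n => \sum_(0 <= i < n) rin (B (F i) g) k) @ \oo
    --> rin (B (\bigcup_n F n) g) k.
  rewrite B_polarization// (_ : (fun n => _) = fun n =>
      \sum_(0 <= i < n) fine (mu (2^-1%:C%C *: (g + k)) (F i)) -
      \sum_(0 <= i < n) fine (mu (2^-1%:C%C *: (g - k)) (F i))).
    by apply: cvgB; exact: mass_cvg.
  apply/funext => n; rewrite -sumrB; apply: eq_bigr => i _.
  by rewrite B_polarization.
have sumE n : \sum_(0 <= i < n) inner (B (F i) g) h =
    Complex (\sum_(0 <= i < n) rin (B (F i) g) h)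
            (\sum_(0 <= i < n) rin (B (F i) g) ('i%C *: h)).
  elim: n => [|n ih]; first by rewrite !big_nil.
  by rewrite !big_nat_recr//= ih innerE.
apply: cvg_complex; under eq_fun do rewrite sumE /=; first exact: rin_cvg.
by rewrite Im_inner; exact: rin_cvg.
Qed.

Definition assembled_povm : povm X H :=
  POVM B_out B_positive B0 BT B_sigma_additive.

End assembly.

Lemma povm_of_measures : exists A : povm X H, forall h (D : set (borel_at x0)),
  measurable D -> povm_diag x0 A h D = mu h D.
Proof.
have /choice[B BP] (D : set X) : exists T : H -> H,
    (borel D -> represents T (fun h => fine (mu h (D : set (borel_at x0))))) /\
    (~ borel D -> T = fun=> 0).
  have [bD|nD] := pselect (borel D); last by exists (fun=> 0).
  by have [T TD] := representable_measure bD; exists T.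
have Brep D := (BP D).1.
exists (assembled_povm Brep (fun D => (BP D).2)) => h D mD.
rewrite povm_diagE /= -(form_rin (Brep D mD)).
by rewrite fineK// fin_num_measure.
Qed.

End povm_of_measures.

(** * The Kantorovich metric and its completeness *)

Section kantorovich_metric.
Context (R : realType) (X : metricType R) (H : hilbertType R).
Implicit Types A B C : povm X H.

Lemma povm_eq A B : (forall D, A D = B D) -> A = B.
Proof.
move=> /funext; case: A B => [a a1 a2 a3 a4 a5] [b b1 b2 b3 b4 b5] /= ab.
subst b; congr POVM; exact: Prop_irrelevance.
Qed.

Lemma kantorovich_ge0 A B : (0 <= kantorovich A B)%E.
Proof.
have f0 : @Lip1 R X (cst 0) by move=> x y; rewrite subrr normr0 mdist_ge0.
apply: le_trans (ereal_sup_ubound (ex_intro2 _ _ _ f0 erefl)).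
apply: (@le_trans _ _ (complex.Re
    `|(povm_integral A (cst 0) \- povm_integral B (cst 0)) 0|)%:E).
  by rewrite lee_fin norm_sqn nrm_ge0.
by apply: ereal_sup_ubound; exists 0 => //=; rewrite normr0.
Qed.

Lemma trivial_kantorovich A B : (forall h : H, h = 0) -> kantorovich A B = 0%E.
Proof.
move=> H0; apply/eqP; rewrite eq_le kantorovich_ge0 andbT.
apply: ub_ereal_sup => _ [f _ <-]; apply: ub_ereal_sup => _ [h _ <-].
by rewrite lee_fin (H0 (_ h)) normr0.
Qed.

Lemma trivial_povm A B : (forall h : H, h = 0) -> A = B.
Proof.
move=> H0; apply: povm_eq => D; apply/funext => h.
by rewrite (H0 (A D h)) (H0 (B D h)).
Qed.

(** On the empty space the identity is A(X), hence A(set0) = 0. *)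
Lemma empty_trivial A : ~ (exists x : X, True) -> forall h : H, h = 0.
Proof.
move=> X0 h; have TE : [set: X] = set0.
  by apply/seteqP; split=> // x _; apply: X0; exists x.
by have := povmT A; rewrite TE povm0 => /(congr1 (@^~ h)).
Qed.

Lemma complete_kantorovich_trivial : ~ (exists x : X, True) ->
  complete_metric (@kantorovich R X H).
Proof.
move=> X0; have k0 A B : kantorovich A B = 0%E.
  exact/trivial_kantorovich/(empty_trivial A).
split; first split=> [A B|A B|A B|A B C]; rewrite ?k0 ?adde0//.
- by rewrite lexx ltry.
- by split=> // _; exact/trivial_povm/(empty_trivial A).
by move=> u _; exists (u 0%N) => e e0; exists 0%N => n _; rewrite k0 lte_fin.
Qed.

Lemma lipschitz_Lip1 (f : X -> R) : lipschitz_fun f ->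
  exists k : R, exists2 g, Lip1 g & 0 < k /\ f = fun x => k * g x.
Proof.
move=> [k fk]; have k0 : 0 < `|k| + 1 by rewrite ltr_wpDl.
exists (`|k| + 1), (fun x => (`|k| + 1)^-1 * f x); last first.
  by split=> //; apply/funext => x; rewrite mulVKf// gt_eqF.
move=> x y; rewrite -mulrBr normrM gtr0_norm ?invr_gt0// ler_pdivrMl//.
rewrite (le_trans (fk x y))// ler_wpM2r ?mdist_ge0//.
by rewrite (le_trans (ler_norm k))// lerDl.
Qed.

Hypothesis compactX : compact [set: X].
Variable Xne : exists x : X, True.
Local Notation x0 := (projT1 (cid Xne)).
Local Notation mu := (povm_diag x0).

Let bm (f : X -> R) : lipschitz_fun f ->
  bounded_measurable (f : borel_at x0 -> R).
Proof. exact: lipschitz_bounded_measurable. Qed.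

(** Since [povm_diag x0 A h] and [povm_diag x0 B h] have the same mass, f may
    be replaced by f - f x0, which is bounded by the diameter. *)
Lemma kantorovich_lty A B : (kantorovich A B < +oo)%E.
Proof.
have ld : lipschitz_fun (fun x : X => mdist x0 x).
  exists 1 => x y; rewrite mul1r ler_norml.
  have := metric_triangle x0 y x; have := metric_triangle x0 x y.
  by rewrite (metric_sym y x) => *; apply/andP; split; lra.
have [M dM] := lipschitz_bounded compactX ld.
have M0 : 0 <= M by rewrite (le_trans _ (dM x0)).
apply: (@le_lt_trans _ _ (M + M)%:E); last exact: ltry.
apply/(kantorovich_leP compactX Xne); first exact: addr_ge0.
move=> f f1 h; have lf := Lip1_lipschitz f1.
have lc := lipschitz_cst X (- f x0).
have le A' : `|\int[mu A' h]_x (f x + - f x0)| <= M * sqn h.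
  rewrite -(povm_diag_mass x0 A'); apply: Rintegral_le_mass => [|x].
    exact: (bm (lipschitzD lf lc)).
  by rewrite distrC (le_trans (f1 x0 x))// (le_trans _ (dM x))// ler_norm.
have E A' : \int[mu A' h]_x (f x + - f x0) =
    \int[mu A' h]_x f x + - f x0 * sqn h.
  rewrite (RintegralD_bounded _ (bm lf) (bm lc)) Rintegral_cst//.
  by rewrite povm_diag_mass.
have -> : \int[mu A h]_x f x - \int[mu B h]_x f x =
    \int[mu A h]_x (f x + - f x0) - \int[mu B h]_x (f x + - f x0).
  by rewrite !E; ring.
by rewrite (le_trans (ler_normB _ _))// mulrDl lerD.
Qed.

Lemma kantorovich_fin_num A B : kantorovich A B \is a fin_num.
Proof. by rewrite ge0_fin_numE ?kantorovich_ge0// kantorovich_lty. Qed.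

Lemma kantorovich_dist A B (f : X -> R) h : Lip1 f ->
  `|\int[mu A h]_x f x - \int[mu B h]_x f x| <= fine (kantorovich A B) * sqn h.
Proof.
move=> f1; move: f f1 h; apply/(kantorovich_leP compactX Xne).
  by rewrite fine_ge0// kantorovich_ge0.
by rewrite fineK// kantorovich_fin_num.
Qed.

Lemma kantorovich_sym A B : kantorovich A B = kantorovich B A.
Proof.
have le A' B' : (kantorovich A' B' <= kantorovich B' A')%E.
  rewrite -(fineK (kantorovich_fin_num B' A')).
  apply/(kantorovich_leP compactX Xne).
    by rewrite fine_ge0// kantorovich_ge0.
  by move=> f f1 h; rewrite distrC kantorovich_dist.
by apply/le_anti/andP; split; exact: le.
Qed.

Lemma kantorovich_triangle A B C :
  (kantorovich A C <= kantorovich A B + kantorovich B C)%E.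
Proof.
rewrite -(fineK (kantorovich_fin_num A B)) -(fineK (kantorovich_fin_num B C)).
rewrite -EFinD; apply/(kantorovich_leP compactX Xne).
  by rewrite addr_ge0// fine_ge0// kantorovich_ge0.
move=> f f1 h; rewrite -(subrKA (\int[mu B h]_x f x)) mulrDl.
by rewrite (le_trans (ler_normD _ _))// lerD// kantorovich_dist.
Qed.

(** The measures of A and B agree on Lipschitz functions, hence on open sets,
    which form a pi-system generating the Borel sets; their forms determine
    A(D) and B(D). *)
Lemma kantorovich_eq0 A B : kantorovich A B = 0%E -> A = B.
Proof.
move=> AB0.
have eq1 f h : Lip1 f -> \int[mu A h]_x f x = \int[mu B h]_x f x.
  move=> f1; have := kantorovich_dist A B h f1.
  by rewrite AB0 mul0r normr_le0 subr_eq0 => /eqP.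
have eqL f h : lipschitz_fun f -> \int[mu A h]_x f x = \int[mu B h]_x f x.
  move=> /lipschitz_Lip1[k [g g1 [_ ->]]].
  by rewrite !RintegralZ_bounded ?eq1//; exact/bm/Lip1_lipschitz.
have eq_open h (U : set X) : open U -> mu A h U = mu B h U.
  move=> oU; have mU : measurable (U : set (borel_at x0)).
    exact: sub_sigma_algebra.
  rewrite -(fineK (fin_num_measure (mu A h) U mU)).
  rewrite -(fineK (fin_num_measure (mu B h) U mU)); congr EFin.
  have cA := @Rintegral_lip_approx_cvg R X U oU x0 compactX (mu A h).
  have cB := @Rintegral_lip_approx_cvg R X U oU x0 compactX (mu B h).
  rewrite -(cvg_lim (@norm_hausdorff _ _) cA) -(cvg_lim (@norm_hausdorff _ _) cB).
  by apply: (congr1 (fun v : R^nat => limn v)); apply/funext => n;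
    exact/eqL/lip_approx_lipschitz.
have eq_borel h (D : set (borel_at x0)) : measurable D -> mu A h D = mu B h D.
  apply: (@measure_unique _ _ (borel_at x0) (@open X) (fun=> setT)) => //.
  - by move=> U V; exact: openI.
  - by move=> _; exact: openT.
  - by apply/seteqP; split=> // x _; exists 0%N.
  - by move=> U oU; exact: eq_open.
  - by move=> _; rewrite -ge0_fin_numE ?fin_num_measure.
apply: povm_eq => D; have [bD|nD] := pselect (borel D); last first.
  by rewrite !povm_out.
apply: (eq_represents (povm_represents A D)).
rewrite (_ : (fun h => _) = fun h => rin (B D h) h); first exact: povm_represents.
by apply/funext => h; have := eq_borel h D bD; rewrite !povm_diagE => -[].
Qed.

Lemma kantorovich_is_metric : is_metric (@kantorovich R X H).
Proof.
split=> [A B|A B|A B|A B C].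
- by rewrite kantorovich_ge0 kantorovich_lty.
- split=> [|->]; first exact: kantorovich_eq0.
  apply/eqP; rewrite eq_le kantorovich_ge0 andbT.
  by apply/(kantorovich_leP compactX Xne) => // f _ h; rewrite subrr normr0 mul0r.
- exact: kantorovich_sym.
- exact: kantorovich_triangle.
Qed.

Section cauchy_sequence.
Variable u : (povm X H)^nat.
Hypothesis u_cauchy : is_cauchy (@kantorovich R X H) u.

Let I n h (f : X -> R) : R := \int[mu (u n) h]_x f x.

Let IZ n h (k : R) g : Lip1 g -> I n h (fun x => k * g x) = k * I n h g.
Proof. by move=> g1; rewrite /I RintegralZ_bounded//; exact/bm/Lip1_lipschitz. Qed.

Let I_cauchy (e : R) : 0 < e ->
  exists N, forall m n, (N <= m)%N -> (N <= n)%N ->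
  forall f, Lip1 f -> forall h, `|I m h f - I n h f| <= e * sqn h.
Proof.
move=> /u_cauchy[N uN]; exists N => m n Nm Nn f f1 h.
rewrite (le_trans (kantorovich_dist _ _ h f1))// ler_wpM2r ?sqn_ge0//.
by rewrite -lee_fin fineK ?kantorovich_fin_num// ltW// uN.
Qed.

Let I_cvg_Lip1 h f : Lip1 f -> cvgn (fun n => I n h f).
Proof.
move=> f1; apply/cauchy_cvgP/cauchy_exP => e e0.
have s0 : 0 < sqn h + 1 by rewrite ltr_wpDl// sqn_ge0.
have [N IN] := I_cauchy (divr_gt0 e0 s0).
exists (I N h f); exists N => // n /= Nn; rewrite -ball_normE /=.
rewrite (le_lt_trans (IN _ _ (leqnn N) Nn f f1 h))// mulrAC ltr_pdivrMr//.
by rewrite ltr_pM2l// ltrDl.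
Qed.

Let I_cvg h f : lipschitz_fun f -> cvgn (fun n => I n h f).
Proof.
move=> /lipschitz_Lip1[k [g g1 [_ ->]]]; under eq_fun do rewrite IZ//.
by apply: is_cvgMr; exact: I_cvg_Lip1.
Qed.

Let L h f : R := limn (fun n => I n h f).

Let LD h f g : lipschitz_fun f -> lipschitz_fun g ->
  L h (fun x => f x + g x) = L h f + L h g.
Proof.
move=> lf lg; rewrite /L -limD; [|exact: I_cvg..].
apply: (congr1 (fun v : R^nat => limn v)); apply/funext => n.
by rewrite /I (RintegralD_bounded _ (bm lf) (bm lg)).
Qed.

Let LZ h (k : R) f : lipschitz_fun f -> L h (fun x => k * f x) = k * L h f.
Proof.
move=> lf; apply: cvg_lim; first exact: norm_hausdorff.
rewrite (_ : (fun n => _) = fun n => k * I n h f).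
  by apply: cvgM; [exact: cvg_cst|exact: I_cvg].
by apply/funext => n; rewrite /I (RintegralZ_bounded _ _ (bm lf)).
Qed.

Let L_ge0 h f : lipschitz_fun f -> (forall x, 0 <= f x) -> 0 <= L h f.
Proof.
move=> lf f0; apply: limr_ge; first exact: I_cvg.
by near=> n; apply: Rintegral_ge0 => x _; exact: f0.
Unshelve. all: by end_near. Qed.

Let Lpos h := PositiveFunctional (@LD h) (@LZ h) (@L_ge0 h).

(** Let m tend to infinity in the Cauchy estimate, whose bound does not depend
    on f or h. *)
Let L_uniform (e : R) : 0 < e -> exists N, forall n, (N <= n)%N ->
  forall f, Lip1 f -> forall h, `|I n h f - L h f| <= e * sqn h.
Proof.
move=> e0; have [N IN] := I_cauchy e0; exists N => n Nn f f1 h.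
have c : (fun m => `|I n h f - I m h f|) @ \oo --> `|I n h f - L h f|.
  by apply: cvg_norm; apply: cvgB; [exact: cvg_cst|exact: I_cvg_Lip1].
rewrite -(cvg_lim (@norm_hausdorff _ _) c); apply: limr_le.
  by apply/cvg_ex; exists `|I n h f - L h f|.
by exists N => // m Nm; exact: IN.
Qed.

Let nu h : {finite_measure set (borel_at x0) -> \bar R} :=
  riesz_measure x0 compactX (Lpos h).

Let nuE f h : lipschitz_fun f -> \int[nu h]_x f x = L h f.
Proof. by move=> lf; exact: (Rintegral_riesz_measure compactX x0 (Lpos h) lf). Qed.

Let nu_mass h : fine (nu h setT) = sqn h.
Proof.
have := nuE h (lipschitz_cst X 1); rewrite Rintegral_cst// mul1r => ->.
rewrite /L (_ : (fun n => _) = fun=> sqn h); first exact: lim_cst.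
by apply/funext => n; rewrite /I Rintegral_cst// mul1r povm_diag_mass.
Qed.

(** The forms of int f d(u n) converge uniformly on the unit ball. *)
Let nu_rep f : lipschitz_fun f -> representable (fun h => \int[nu h]_x f x).
Proof.
move=> lf; rewrite (_ : (fun h => _) = fun h => L h f); last first.
  by apply/funext => h; exact: nuE.
apply: (@representable_uniform _ _ (fun n h => I n h f)) => [n|e e0].
  exists (povm_integral (u n) f); apply: povm_integral_represents; exact: bm.
have [k [g g1 [k0 fE]]] := lipschitz_Lip1 lf.
have [N LN] := L_uniform (divr_gt0 e0 k0); exists N => n Nn h.
rewrite fE IZ// LZ; last exact: Lip1_lipschitz.
rewrite -mulrBr normrM gtr0_norm// mulrC -ler_pdivlMr// mulrAC.
exact: LN.
Qed.

Lemma kantorovich_cauchy_cvg : exists A, converges_to (@kantorovich R X H) u A.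
Proof.
have [A AE] := povm_of_measures compactX nu_mass nu_rep.
exists A => e e0; have e20 : 0 < e / 2 by rewrite divr_gt0.
have [N LN] := L_uniform e20; exists N => n Nn.
apply: (@le_lt_trans _ _ (e / 2)%:E); last by rewrite lte_fin; lra.
apply/(kantorovich_leP compactX Xne); first exact: ltW.
move=> f f1 h; rewrite (_ : \int[mu A h]_x f x = L h f); first exact: LN.
rewrite -nuE; last exact: Lip1_lipschitz.
by congr fine; apply: eq_measure_integral => D mD _; exact: AE.
Qed.

End cauchy_sequence.

Lemma complete_kantorovich : complete_metric (@kantorovich R X H).
Proof. by split; [exact: kantorovich_is_metric|exact: kantorovich_cauchy_cvg]. Qed.

End kantorovich_metric.

Theorem theorem2p19 (R : realType) (X : metricType R)
    (compactX : compact [set: X]) (H : hilbertType R) :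
  complete_metric (@kantorovich R X H).
Proof.
have [Xne|X0] := pselect (exists x : X, True).
  exact: complete_kantorovich.
exact: complete_kantorovich_trivial.
Qed.
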